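(* Let $\lambda\ge1$ and $s\ge0$ be integers, and let $z\in\mathbb{C}$ with $|z|<1$ and $z\neq\bar z$. Let $$\Sigma_s^{(\lambda)}(z,\bar z)=\sum_{n=0}^\infty C_n^{(\lambda)}\!\left(\frac{z+\bar z}{2\sqrt{z\bar z}}\right)(z\bar z)^{n/2}\,\frac{1}{(\lambda+n)^s}.$$ Then $$\Sigma_s^{(\lambda)}(z,\bar z)=P_\lambda(z\partial_z)\,\frac{\operatorname{Li}_s(z)}{(z-\bar z)^\lambda}+P_\lambda(\bar z\partial_{\bar z})\,\frac{\operatorname{Li}_s(\bar z)}{(\bar z-z)^\lambda},$$ where $$P_\lambda(z\partial_z)=\frac{1}{(\lambda-1)!}(z\partial_z+1)(z\partial_z+2)\cdots(z\partial_z+\lambda-1)=\frac{1}{\Gamma(\lambda)}\,\partial_z^{\lambda-1}z^{\lambda-1},\qquad P_1=1,$$ and $P_\lambda(\bar z\partial_{\bar z})$ is the same operator with $z$ replaced by $\bar z$.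
   Context: $\bar z$ is the complex conjugate of $z$; $\partial_z,\partial_{\bar z}$ are Wirtinger derivatives ($z,\bar z$ are treated as independent variables under differentiation). $C_n^{(\lambda)}$ are the Gegenbauer polynomials, $\sum_{n\ge0}C_n^{(\lambda)}(r)t^n=(1-2rt+t^2)^{-\lambda}$. $\operatorname{Li}_s(z)=\sum_{n\ge1}z^n/n^s$ is the polylogarithm. In the expression $\partial_z^{\lambda-1}z^{\lambda-1}$, $z^{\lambda-1}$ denotes the operator of multiplication, applied first. *)

(* Defs.v *)
From Stdlib Require Export Reals Factorial.
From Coquelicot Require Export Coquelicot.
Open Scope R_scope.

(* Taylor coefficient of order n at t = 0 of the generating function
   (1 - 2 r t + t^2)^(-lam), for an integer parameter lam. *)
Definition gegenbauer (lam n : nat) (r : R) : R :=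
  Derive_n (fun t : R => / (1 - 2 * r * t + t ^ 2) ^ lam) n 0 / INR (fact n).

(* Total: Series returns an unspecified value on divergent series. *)
Definition CSeries (a : nat -> C) : C :=
  (Series (fun n => Re (a n)), Series (fun n => Im (a n))).

(* The sum over n >= 1 of z^n / n^s, shifted to start at 0. *)
Definition polylog (s : nat) (z : C) : C :=
  CSeries (fun n : nat => (Cpow z (S n) / RtoC (INR (S n) ^ s))%C).

(* Euler's integral; meaningful for x > 0. *)
Definition Gamma (x : R) : R :=
  RInt_gen (fun t : R => Rpower t (x - 1) * exp (- t))
    (at_right 0) (Rbar_locally p_infty).

(* Real partial derivatives of f at w = x + i y. *)
Definition partial_x (f : C -> C) (w : C) : C :=
  (Derive (fun t : R => Re (f (t, Im w))) (Re w),
   Derive (fun t : R => Im (f (t, Im w))) (Re w)).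

Definition partial_y (f : C -> C) (w : C) : C :=
  (Derive (fun t : R => Re (f (Re w, t))) (Im w),
   Derive (fun t : R => Im (f (Re w, t))) (Im w)).

Definition wirtinger (f : C -> C) (w : C) : C :=
  (RtoC (/ 2) * (partial_x f w - Ci * partial_y f w))%C.

Definition wirtinger_bar (f : C -> C) (w : C) : C :=
  (RtoC (/ 2) * (partial_x f w + Ci * partial_y f w))%C.

Definition ex_partials (f : C -> C) (w : C) : Prop :=
  (ex_derive (fun t : R => Re (f (t, Im w))) (Re w) /\
   ex_derive (fun t : R => Im (f (t, Im w))) (Re w)) /\
  (ex_derive (fun t : R => Re (f (Re w, t))) (Im w) /\
   ex_derive (fun t : R => Im (f (Re w, t))) (Im w)).

(* Class C^k in the real sense on an open set U. *)
Fixpoint is_Ck (k : nat) (U : C -> Prop) (f : C -> C) : Prop :=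
  match k with
  | O => forall w : C, U w ->
      @continuous C_UniformSpace C_UniformSpace f w
  | S k' => (forall w : C, U w -> ex_partials f w) /\
      is_Ck k' U (partial_x f) /\ is_Ck k' U (partial_y f)
  end.

(* In the operators below D is a derivation (wirtinger or wirtinger_bar) and
   c is the coordinate function it pairs with (the identity or Cconj). *)
Definition euler_op (D : (C -> C) -> C -> C) (c : C -> C)
  (f : C -> C) (w : C) : C := (c w * D f w)%C.

(* (c D + 1) (c D + 2) ... (c D + m), the rightmost factor acting first. *)
Fixpoint euler_prod (D : (C -> C) -> C -> C) (c : C -> C) (m : nat)
  (f : C -> C) : C -> C :=
  match m with
  | O => f
  | S m' => euler_prod D c m'
      (fun w : C => (euler_op D c f w + RtoC (INR (S m')) * f w)%C)
  end.

Definition P_op (D : (C -> C) -> C -> C) (c : C -> C) (lam : nat)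
  (f : C -> C) (w : C) : C :=
  (RtoC (/ INR (fact (lam - 1))) * euler_prod D c (lam - 1) f w)%C.

Definition P_op_deriv (D : (C -> C) -> C -> C) (c : C -> C) (lam : nat)
  (f : C -> C) (w : C) : C :=
  (RtoC (/ Gamma (INR lam)) *
   Nat.iter (lam - 1) D (fun v : C => Cpow (c v) (lam - 1) * f v) w)%C.

Definition Pz : nat -> (C -> C) -> C -> C := P_op wirtinger (fun v => v).
Definition Pzbar : nat -> (C -> C) -> C -> C := P_op wirtinger_bar Cconj.
Definition Pz_deriv : nat -> (C -> C) -> C -> C :=
  P_op_deriv wirtinger (fun v => v).
Definition Pzbar_deriv : nat -> (C -> C) -> C -> C :=
  P_op_deriv wirtinger_bar Cconj.

(* For complex z both z + Cconj z and z * Cconj z have zero imaginary part;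
   Re turns them into the real numbers they are. *)
Definition sigma_term (lam s : nat) (z : C) (n : nat) : R :=
  gegenbauer lam n (Re (z + Cconj z)%C / (2 * sqrt (Re (z * Cconj z)%C)))
  * Rpower (Re (z * Cconj z)%C) (INR n / 2)
  * / INR (lam + n) ^ s.

(* Main.v *)
(** Write w for the conjugate of z and d = z - w. With D the derivative
    in z, the operator P_lam is D^(lam-1) z^(lam-1) / (lam-1)!, so for each k it
    sends z^k / d^lam to the residue at x = z of
    x^(k+lam-1) / ((x - z)^lam (x - w)^lam). The conjugate term supplies the
    residue at x = w, and the two residues add up to the coefficient of u^(k-lam)
    in 1 / ((1 - z u) (1 - w u))^lam, a Gegenbauer polynomial times |z|^(k-lam),
    which is 0 for 1 <= k < lam. It remains to sum over k with weights 1 / k^s.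

    Residues are handled through the recursion in the two pole orders that
    comes from (x - w) - (x - z) = d. *)

Require Import Defs.
From Stdlib Require Import Reals Factorial Lra Lia FunctionalExtensionality.
From Coquelicot Require Import Coquelicot.

(** * Partial derivatives and Wirtinger operators *)

(** The obstacle is to carry the operator past an infinite sum. Exchanging D with the sum over k
    would call for uniform estimates on all derivatives of z^k / d^lam. Instead the operator acts on
    the closed function: z^(lam-1) Li_s(z) / d^lam is a residue at a simple pole, each D raises the
    order of that pole by one, and the outcome is a finite expression, linear in the Taylor
    coefficients at z of x^(lam-1) Li_s(x). Only these coefficients are infinite sums, so expanding
    the result in k is a finite linear manipulation of convergent series. The analysis left is that
    D sends the p-th Taylor coefficient to p + 1 times the next one, for power series with
    coefficients bounded by 1.

    Only the operator in z is analysed: conjugation carries it to the barred one, and since the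
    coefficients of Li_s are real, the second term of the formula is the conjugate of the first.

    No contour and no expansion at infinity occurs: the sum of the two residues and the Gegenbauer
    coefficients are shown to obey the same recurrence. *)

Definition is_cderive (g : R -> C) (x : R) (l : C) : Prop :=
  is_derive (fun t => Re (g t)) x (Re l) /\
  is_derive (fun t => Im (g t)) x (Im l).

(** [partial_x] and [partial_y] are total, so their values alone do not compose; this relation
    carries existence along with the values. *)
Definition is_partials (f : C -> C) (w fx fy : C) : Prop :=
  is_cderive (fun t => f (t, Im w)) (Re w) fx /\
  is_cderive (fun t => f (Re w, t)) (Im w) fy.

Lemma is_cderive_const (a : C) (x : R) : is_cderive (fun _ => a) x 0%C.
Proof. split; simpl; apply (@is_derive_const R_AbsRing R_NormedModule). Qed.

Lemma is_cderive_plus (f g : R -> C) (x : R) (l m : C) :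
  is_cderive f x l -> is_cderive g x m ->
  is_cderive (fun t => (f t + g t)%C) x (l + m)%C.
Proof.
  intros [Hf1 Hf2] [Hg1 Hg2]; split; simpl.
  - exact (is_derive_plus _ _ _ _ _ Hf1 Hg1).
  - exact (is_derive_plus _ _ _ _ _ Hf2 Hg2).
Qed.

Lemma is_derive_eq (f : R -> R) (x l l' : R) :
  l = l' -> is_derive f x l -> is_derive f x l'.
Proof. intros ->; auto. Qed.

Lemma is_cderive_mult (f g : R -> C) (x : R) (l m : C) :
  is_cderive f x l -> is_cderive g x m ->
  is_cderive (fun t => (f t * g t)%C) x (l * g x + f x * m)%C.
Proof.
  intros [Hf1 Hf2] [Hg1 Hg2]; split; simpl.
  - refine (is_derive_eq _ _ _ _ _ (is_derive_minus _ _ _ _ _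
      (is_derive_mult _ _ _ _ _ Hf1 Hg1 Rmult_comm)
      (is_derive_mult _ _ _ _ _ Hf2 Hg2 Rmult_comm))).
    unfold minus, plus, opp, mult; simpl; unfold Re, Im; ring.
  - refine (is_derive_eq _ _ _ _ _ (is_derive_plus _ _ _ _ _
      (is_derive_mult _ _ _ _ _ Hf1 Hg2 Rmult_comm)
      (is_derive_mult _ _ _ _ _ Hf2 Hg1 Rmult_comm))).
    unfold minus, plus, opp, mult; simpl; unfold Re, Im; ring.
Qed.

Lemma sum_squares_neq_0 (z : C) : z <> 0 -> Re z ^ 2 + Im z ^ 2 <> 0.
Proof.
  intros Hz H; apply Hz; destruct z as [a b]; simpl in H.
  apply injective_projections; simpl; nra.
Qed.

(** Phrased with two real components so that [auto_derive] can work on the real quotients that make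
    up [Cinv]. *)
Lemma is_derive_Cinv (u v : R -> R) (x a b : R) :
  u x ^ 2 + v x ^ 2 <> 0 -> is_derive u x a -> is_derive v x b ->
  is_derive (fun t => Re (/ (u t, v t))%C) x
    (Re (- (a, b) / ((u x, v x) * (u x, v x)))%C) /\
  is_derive (fun t => Im (/ (u t, v t))%C) x
    (Im (- (a, b) / ((u x, v x) * (u x, v x)))%C).
Proof.
  intros H0 Hu Hv.
  assert (Eu : Derive (fun t => u t) x = a) by apply (is_derive_unique _ _ _ Hu).
  assert (Ev : Derive (fun t => v t) x = b) by apply (is_derive_unique _ _ _ Hv).
  assert (Hd : (u x * u x - v x * v x) ^ 2 + (u x * v x + v x * u x) ^ 2 <> 0).
  { replace (_ + _) with ((u x ^ 2 + v x ^ 2) ^ 2) by ring.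
    apply pow_nonzero; auto. }
  unfold Re, Im; simpl; simpl in H0, Hd.
  split; auto_derive;
    try (repeat split; try (eexists; eassumption); simpl in *; lra);
    rewrite Eu, Ev; field; rewrite !Rmult_1_r in *; auto.
Qed.

Lemma is_cderive_inv (f : R -> C) (x : R) (l : C) :
  f x <> 0 -> is_cderive f x l ->
  is_cderive (fun t => (/ f t)%C) x (- l / (f x * f x))%C.
Proof.
  intros H0%sum_squares_neq_0 [H1 H2].
  assert (H := is_derive_Cinv _ _ x _ _ H0 H1 H2).
  destruct l as [a b]; unfold is_cderive; revert H.
  unfold Re, Im, Cinv; simpl; destruct (f x); auto.
Qed.

Lemma is_partials_unique (f : C -> C) (w fx fy : C) :
  is_partials f w fx fy -> partial_x f w = fx /\ partial_y f w = fy.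
Proof.
  intros [[H1 H2] [H3 H4]]; split; apply injective_projections; simpl;
    apply is_derive_unique; assumption.
Qed.

Lemma is_partials_ex (f : C -> C) (w fx fy : C) :
  is_partials f w fx fy -> ex_partials f w.
Proof.
  intros [[H1 H2] [H3 H4]]; repeat split; eexists; eassumption.
Qed.

Lemma ex_partials_correct (f : C -> C) (w : C) :
  ex_partials f w -> is_partials f w (partial_x f w) (partial_y f w).
Proof.
  intros [[H1 H2] [H3 H4]]; split; split; apply Derive_correct; assumption.
Qed.

Lemma is_partials_const (a w : C) : is_partials (fun _ => a) w 0%C 0%C.
Proof. split; apply is_cderive_const. Qed.

Lemma is_partials_id (w : C) : is_partials (fun v => v) w 1%C Ci.
Proof.
  split; split; simpl;
    first [apply (@is_derive_id R_AbsRing)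
          | apply (@is_derive_const R_AbsRing R_NormedModule)].
Qed.

Lemma is_partials_conj (f : C -> C) (w fx fy : C) :
  is_partials f w fx fy ->
  is_partials (fun v => Cconj (f v)) w (Cconj fx) (Cconj fy).
Proof.
  intros [[H1 H2] [H3 H4]]; split; split; try assumption;
    apply (is_derive_opp (V := R_NormedModule)); assumption.
Qed.

Lemma is_partials_plus (f g : C -> C) (w fx fy gx gy : C) :
  is_partials f w fx fy -> is_partials g w gx gy ->
  is_partials (fun v => (f v + g v)%C) w (fx + gx)%C (fy + gy)%C.
Proof.
  intros [H1 H2] [H3 H4]; split; apply is_cderive_plus; auto.
Qed.

Lemma is_partials_mult (f g : C -> C) (w fx fy gx gy : C) :
  is_partials f w fx fy -> is_partials g w gx gy ->
  is_partials (fun v => (f v * g v)%C) w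
    (fx * g w + f w * gx)%C (fy * g w + f w * gy)%C.
Proof.
  destruct w as [x y]; intros [H1 H2] [H3 H4]; split.
  - exact (is_cderive_mult _ _ _ _ _ H1 H3).
  - exact (is_cderive_mult _ _ _ _ _ H2 H4).
Qed.

Lemma is_partials_inv (f : C -> C) (w fx fy : C) :
  f w <> 0 -> is_partials f w fx fy ->
  is_partials (fun v => (/ f v)%C) w
    (- fx / (f w * f w))%C (- fy / (f w * f w))%C.
Proof.
  destruct w as [x y]; intros H0 [H1 H2]; split.
  - exact (is_cderive_inv _ _ _ H0 H1).
  - exact (is_cderive_inv _ _ _ H0 H2).
Qed.

Lemma open_slices (U : C -> Prop) (w : C) :
  @open C_UniformSpace U -> U w ->
  locally (Re w) (fun t => U (t, Im w)) /\
  locally (Im w) (fun t => U (Re w, t)).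
Proof.
  intros HU Hw; destruct (HU w Hw) as [e He].
  split; exists e; intros t Ht; apply He; split; simpl; auto;
    apply ball_center.
Qed.

Lemma is_partials_ext (U : C -> Prop) (f g : C -> C) (w fx fy : C) :
  @open C_UniformSpace U -> (forall v, U v -> f v = g v) -> U w ->
  is_partials f w fx fy -> is_partials g w fx fy.
Proof.
  intros HU Hfg Hw [[H1 H2] [H3 H4]].
  destruct (open_slices U w HU Hw) as [Hx Hy].
  split; split; (eapply is_derive_ext_loc; [| eassumption]);
    (eapply filter_imp; [| first [exact Hx | exact Hy]]);
    simpl; intros t Ht; rewrite Hfg; auto.
Qed.

Lemma partials_ext (U : C -> Prop) (f g : C -> C) (w : C) :
  @open C_UniformSpace U -> (forall v, U v -> f v = g v) -> U w ->
  partial_x f w = partial_x g w /\ partial_y f w = partial_y g w.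
Proof.
  intros HU Hfg Hw; destruct (open_slices U w HU Hw) as [Hx Hy].
  unfold partial_x, partial_y; split; f_equal; apply Derive_ext_loc;
    (eapply filter_imp; [| first [exact Hx | exact Hy]]);
    simpl; intros t Ht; rewrite Hfg; auto.
Qed.

Lemma wirtinger_ext (U : C -> Prop) (f g : C -> C) (w : C) :
  @open C_UniformSpace U -> (forall v, U v -> f v = g v) -> U w ->
  wirtinger f w = wirtinger g w.
Proof.
  intros HU Hfg Hw; unfold wirtinger.
  destruct (partials_ext U f g w) as [-> ->]; auto.
Qed.

Lemma wirtinger_is_partials (f : C -> C) (w fx fy : C) :
  is_partials f w fx fy -> wirtinger f w = (RtoC (/ 2) * (fx - Ci * fy))%C.
Proof.
  intros H; unfold wirtinger.
  destruct (is_partials_unique _ _ _ _ H) as [-> ->]; auto.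
Qed.

(* Unlike [is_Ck], this asks for no continuity; then monotonicity in [k] is
   immediate and products need only the Leibniz rule. *)
Fixpoint iter_partials (k : nat) (U : C -> Prop) (f : C -> C) : Prop :=
  match k with
  | O => True
  | S k' => (forall w : C, U w -> ex_partials f w) /\
      iter_partials k' U (partial_x f) /\ iter_partials k' U (partial_y f)
  end.

Lemma is_Ck_iter_partials (k : nat) (U : C -> Prop) (f : C -> C) :
  is_Ck k U f -> iter_partials k U f.
Proof.
  revert f; induction k as [| k IH]; intros f H; simpl in *; auto.
  destruct H as [H1 [H2 H3]]; auto.
Qed.

Lemma iter_partials_S (k : nat) (U : C -> Prop) (f : C -> C) :
  iter_partials (S k) U f -> iter_partials k U f.
Proof.
  revert f; induction k as [| k IH]; intros f H; simpl; auto.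
  destruct H as [H1 [H2 H3]]; auto.
Qed.

Section IterPartials.

Variable U : C -> Prop.
Hypothesis HU : @open C_UniformSpace U.

Lemma iter_partials_ext (k : nat) (f g : C -> C) :
  (forall v, U v -> f v = g v) -> iter_partials k U f -> iter_partials k U g.
Proof.
  revert f g; induction k as [| k IH]; intros f g Hfg H; simpl; auto.
  destruct H as [H1 [H2 H3]]; split; [| split].
  - intros w Hw; eapply is_partials_ex, (is_partials_ext U f g); auto.
    apply ex_partials_correct; auto.
  - apply (IH (partial_x f)); auto; intros v Hv.
    apply (partials_ext U f g v); auto.
  - apply (IH (partial_y f)); auto; intros v Hv.
    apply (partials_ext U f g v); auto.
Qed.

(** Lets the partials be named by any formulas valid on [U]; off [U] nothing is known about
    [partial_x f] and [partial_y f]. *)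
Lemma iter_partials_intro (k : nat) (f fx fy : C -> C) :
  (forall w, U w -> is_partials f w (fx w) (fy w)) ->
  iter_partials k U fx -> iter_partials k U fy -> iter_partials (S k) U f.
Proof.
  intros H Hx Hy; split; [| split].
  - intros w Hw; eapply is_partials_ex; eauto.
  - apply (iter_partials_ext k fx); auto; intros v Hv; symmetry.
    apply (is_partials_unique f v (fx v) (fy v)); auto.
  - apply (iter_partials_ext k fy); auto; intros v Hv; symmetry.
    apply (is_partials_unique f v (fx v) (fy v)); auto.
Qed.

Lemma iter_partials_is_partials (k : nat) (f : C -> C) (w : C) :
  iter_partials (S k) U f -> U w ->
  is_partials f w (partial_x f w) (partial_y f w).
Proof. intros [H _] Hw; apply ex_partials_correct; auto. Qed.

Lemma iter_partials_const (k : nat) (a : C) : iter_partials k U (fun _ => a).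
Proof.
  revert a; induction k as [| k IH]; intros a; [exact I |].
  apply (iter_partials_intro _ _ (fun _ => 0%C) (fun _ => 0%C)); auto.
  intros; apply is_partials_const.
Qed.

Lemma iter_partials_id (k : nat) : iter_partials k U (fun v => v).
Proof.
  destruct k as [| k]; [exact I |].
  apply (iter_partials_intro _ _ (fun _ => 1%C) (fun _ => Ci));
    try apply iter_partials_const.
  intros; apply is_partials_id.
Qed.

Lemma iter_partials_plus (k : nat) (f g : C -> C) :
  iter_partials k U f -> iter_partials k U g ->
  iter_partials k U (fun v => (f v + g v)%C).
Proof.
  revert f g; induction k as [| k IH]; intros f g Hf Hg; [exact I |].
  eapply iter_partials_intro.
  - intros w Hw; apply is_partials_plus;
      apply (iter_partials_is_partials k); auto.
  - apply IH; [apply Hf | apply Hg].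
  - apply IH; [apply Hf | apply Hg].
Qed.

Lemma iter_partials_mult (k : nat) (f g : C -> C) :
  iter_partials k U f -> iter_partials k U g ->
  iter_partials k U (fun v => (f v * g v)%C).
Proof.
  revert f g; induction k as [| k IH]; intros f g Hf Hg; [exact I |].
  assert (Hf' := iter_partials_S _ _ _ Hf).
  assert (Hg' := iter_partials_S _ _ _ Hg).
  eapply (iter_partials_intro _ _
    (fun w => (partial_x f w * g w + f w * partial_x g w)%C)
    (fun w => (partial_y f w * g w + f w * partial_y g w)%C)).
  - intros w Hw; apply is_partials_mult;
      apply (iter_partials_is_partials k); auto.
  - apply iter_partials_plus; apply IH; auto; [apply Hf | apply Hg].
  - apply iter_partials_plus; apply IH; auto; [apply Hf | apply Hg].
Qed.

Lemma iter_partials_pow (k n : nat) (f : C -> C) :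
  iter_partials k U f -> iter_partials k U (fun v => (f v ^ n)%C).
Proof.
  intros Hf; induction n as [| n IH]; simpl.
  - apply iter_partials_const.
  - apply iter_partials_mult; auto.
Qed.

(** The partials of 1/f are -f' (1/f)^2, so order k of 1/f gives order k + 1 by products alone. *)
Lemma iter_partials_inv (k : nat) (f : C -> C) :
  (forall w, U w -> f w <> 0) ->
  iter_partials k U f -> iter_partials k U (fun v => (/ f v)%C).
Proof.
  intros H0; induction k as [| k IH]; intros Hf; [exact I |].
  assert (Hi := IH (iter_partials_S _ _ _ Hf)).
  apply (iter_partials_intro _ _
    (fun w => ((RtoC (-1) * partial_x f w) * (/ f w * / f w))%C)
    (fun w => ((RtoC (-1) * partial_y f w) * (/ f w * / f w))%C)).
  - intros w Hw; specialize (H0 w Hw).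
    replace (RtoC (-1) * partial_x f w * (/ f w * / f w))%C
      with (- partial_x f w / (f w * f w))%C by (field; auto).
    replace (RtoC (-1) * partial_y f w * (/ f w * / f w))%C
      with (- partial_y f w / (f w * f w))%C by (field; auto).
    apply is_partials_inv; auto; apply (iter_partials_is_partials k); auto.
  - repeat apply iter_partials_mult; auto;
      [apply iter_partials_const | apply Hf].
  - repeat apply iter_partials_mult; auto;
      [apply iter_partials_const | apply Hf].
Qed.

Lemma iter_partials_wirtinger (k : nat) (f : C -> C) :
  iter_partials (S k) U f -> iter_partials k U (wirtinger f).
Proof.
  intros [_ [Hx Hy]]; unfold wirtinger.
  apply (iter_partials_ext k (fun w => (RtoC (/ 2) *
    (partial_x f w + RtoC (-1) * (Ci * partial_y f w)))%C)).
  - intros; ring.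
  - apply iter_partials_mult; [apply iter_partials_const |].
    apply iter_partials_plus; auto.
    repeat apply iter_partials_mult; auto; apply iter_partials_const.
Qed.

Lemma wirtinger_mult (f g : C -> C) (w : C) :
  ex_partials f w -> ex_partials g w ->
  wirtinger (fun v => (f v * g v)%C) w =
  (wirtinger f w * g w + f w * wirtinger g w)%C.
Proof.
  intros Hf%ex_partials_correct Hg%ex_partials_correct.
  rewrite (wirtinger_is_partials _ _ _ _ (is_partials_mult _ _ _ _ _ _ _ Hf Hg)).
  unfold wirtinger; ring.
Qed.

Lemma wirtinger_iter_ext (n : nat) (f g : C -> C) :
  (forall v, U v -> f v = g v) -> forall w, U w ->
  Nat.iter n wirtinger f w = Nat.iter n wirtinger g w.
Proof.
  intros Hfg; induction n as [| n IH]; simpl; auto.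
  intros w Hw; apply (wirtinger_ext U); auto.
Qed.

Lemma is_partials_pow_id (m : nat) (w : C) :
  is_partials (fun v => (v ^ S m)%C) w
    (RtoC (INR (S m)) * w ^ m)%C (Ci * (RtoC (INR (S m)) * w ^ m))%C.
Proof.
  induction m as [| m IH].
  - assert (H := is_partials_mult _ _ _ _ _ _ _ (is_partials_id w)
      (is_partials_const 1 w)).
    simpl; simpl in H.
    replace (RtoC 1 * RtoC 1)%C with (1 * 1 + w * 0)%C by ring.
    replace (Ci * (1 * 1 + w * 0))%C with (Ci * 1 + w * 0)%C by ring.
    exact H.
  - assert (H := is_partials_mult _ _ _ _ _ _ _ (is_partials_id w) IH).
    replace (RtoC (INR (S (S m))) * w ^ S m)%C
      with (1 * w ^ S m + w * (RtoC (INR (S m)) * w ^ m))%C.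
    2:{ rewrite (S_INR (S m)), RtoC_plus; simpl Cpow; ring. }
    replace (Ci * (1 * w ^ S m + w * (RtoC (INR (S m)) * w ^ m)))%C with
     (Ci * w ^ S m + w * (Ci * (RtoC (INR (S m)) * w ^ m)))%C by ring.
    exact H.
Qed.

(** The Cauchy-Riemann case: when the y-partial is i times the x-partial, [wirtinger] is the complex
    derivative. *)
Lemma wirtinger_holomorphic (a : C) : (RtoC (/ 2) * (a - Ci * (Ci * a)))%C = a.
Proof. apply injective_projections; simpl; field. Qed.

Lemma wirtinger_pow (m : nat) (w : C) :
  wirtinger (fun v => (v ^ S m)%C) w = (RtoC (INR (S m)) * w ^ m)%C.
Proof.
  rewrite (wirtinger_is_partials _ _ _ _ (is_partials_pow_id m w)).
  apply wirtinger_holomorphic.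
Qed.

(* [D (c^(m+1) f) = c^m (c D + m + 1) f], so each factor absorbs one power of
   the coordinate. *)
Lemma euler_prod_wirtinger (m : nat) (f : C -> C) :
  iter_partials m U f -> forall w, U w ->
  euler_prod wirtinger (fun v => v) m f w =
  Nat.iter m wirtinger (fun v => (v ^ m * f v)%C) w.
Proof.
  revert f; induction m as [| m IH]; intros f Hf w Hw.
  - simpl; ring.
  - rewrite Nat.iter_succ_r; cbn [euler_prod].
    rewrite IH; auto.
    + apply wirtinger_iter_ext; auto; intros v Hv.
      rewrite wirtinger_mult; [| eapply is_partials_ex, is_partials_pow_id
                               | apply Hf; auto].
      rewrite wirtinger_pow; unfold euler_op; simpl Cpow; ring.
    + apply iter_partials_plus; unfold euler_op.
      * apply iter_partials_mult; [apply iter_partials_id |].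
        apply iter_partials_wirtinger; auto.
      * apply iter_partials_mult; [apply iter_partials_const |].
        apply iter_partials_S; auto.
Qed.

End IterPartials.

(** The total [Derive] commutes with negation for every function, so the identity is unconditional
    and may be iterated by function extensionality. Every barred statement below reduces to an
    unbarred one through it. *)
Lemma wirtinger_bar_conj (f : C -> C) (w : C) :
  wirtinger_bar f w = Cconj (wirtinger (fun v => Cconj (f v)) w).
Proof.
  unfold wirtinger, wirtinger_bar, partial_x, partial_y; simpl.
  rewrite !Derive_opp.
  apply injective_projections; unfold Re, Im; simpl; ring.
Qed.

Lemma wirtinger_bar_iter (n : nat) (f : C -> C) (w : C) :
  Nat.iter n wirtinger_bar f w =
  Cconj (Nat.iter n wirtinger (fun v => Cconj (f v)) w).
Proof.
  revert w; induction n as [| n IH]; intros w; simpl.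
  - symmetry; apply Cconj_conj.
  - rewrite wirtinger_bar_conj; do 2 f_equal.
    apply functional_extensionality; intros v.
    rewrite IH; apply Cconj_conj.
Qed.

Lemma euler_prod_bar (m : nat) (f : C -> C) (w : C) :
  euler_prod wirtinger_bar Cconj m f w =
  Cconj (euler_prod wirtinger (fun v => v) m (fun v => Cconj (f v)) w).
Proof.
  revert f w; induction m as [| m IH]; intros f w; cbn [euler_prod].
  - symmetry; apply Cconj_conj.
  - rewrite IH; do 2 f_equal.
    apply functional_extensionality; intros v; unfold euler_op.
    rewrite wirtinger_bar_conj, Cplus_conj, !Cmult_conj, !Cconj_conj.
    do 2 f_equal. apply injective_projections; simpl; ring.
Qed.

Lemma Pzbar_conj (lam : nat) (f : C -> C) (w : C) :
  Pzbar lam f w = Cconj (Pz lam (fun v => Cconj (f v)) w).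
Proof.
  unfold Pzbar, Pz, P_op; rewrite euler_prod_bar, Cmult_conj.
  f_equal; apply injective_projections; simpl; ring.
Qed.

Lemma Pzbar_deriv_conj (lam : nat) (f : C -> C) (w : C) :
  Pzbar_deriv lam f w = Cconj (Pz_deriv lam (fun v => Cconj (f v)) w).
Proof.
  unfold Pzbar_deriv, Pz_deriv, P_op_deriv; rewrite wirtinger_bar_iter, Cmult_conj.
  f_equal; [apply injective_projections; simpl; ring |].
  do 2 f_equal; apply functional_extensionality; intros v.
  rewrite Cmult_conj, Cpow_conj, Cconj_conj; auto.
Qed.

Lemma iter_partials_conj (U : C -> Prop) (k : nat) (f : C -> C) :
  @open C_UniformSpace U ->
  iter_partials k U f -> iter_partials k U (fun v => Cconj (f v)).
Proof.
  intros HU; revert f; induction k as [| k IH]; intros f Hf; [exact I |].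
  eapply (iter_partials_intro U HU).
  - intros w Hw; apply is_partials_conj.
    apply (iter_partials_is_partials U k); auto.
  - apply IH, Hf.
  - apply IH, Hf.
Qed.

(** * The Gamma function at positive integers *)

(** The primitive of t^n exp(-t) produced by repeated integration by parts. *)
Fixpoint gamma_primitive (n : nat) (t : R) : R :=
  match n with
  | O => - exp (- t)
  | S n' => INR n * gamma_primitive n' t - t ^ n * exp (- t)
  end.

Lemma gamma_primitive_derive (n : nat) (t : R) :
  is_derive (gamma_primitive n) t (t ^ n * exp (- t)).
Proof.
  induction n as [| n IH]; cbn [gamma_primitive].
  - auto_derive; auto; simpl; ring.
  - auto_derive.
    + first [eexists; exact IH | split; [eexists; exact IH | auto]].
    + change (fun x => gamma_primitive n x) with (gamma_primitive n).
      rewrite (is_derive_unique _ _ _ IH); cbn [Nat.pred pow]. ring.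
Qed.

Lemma gamma_primitive_0 (n : nat) : gamma_primitive n 0 = - INR (fact n).
Proof.
  induction n as [| n IH].
  - simpl; rewrite Ropp_0, exp_0; lra.
  - cbn [gamma_primitive]; rewrite IH, pow_i, fact_simpl, mult_INR by lia; ring.
Qed.

(** The exponential series dominates its single term t^(n+1) / (n+1)!. *)
Lemma pow_exp_le (n : nat) (t : R) :
  0 < t -> t ^ n * exp (- t) <= INR (fact (S n)) * / t.
Proof.
  intros Ht.
  assert (H : t ^ S n / INR (fact (S n)) <= exp t).
  { apply Rle_trans with (2 := exp_ge_taylor t (S n) (Rlt_le _ _ Ht)).
    rewrite tech5.
    assert (0 <= sum_f_R0 (fun k => t ^ k / INR (fact k)) n); [| lra].
    apply cond_pos_sum; intros k; apply Rmult_le_pos;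
      [apply pow_le; lra | apply Rlt_le, Rinv_0_lt_compat, INR_fact_lt_0]. }
  assert (Hf := INR_fact_lt_0 (S n)); assert (He := exp_pos t).
  rewrite exp_Ropp; apply Rmult_le_reg_r with (t * exp t); [nra |].
  replace (t ^ n * / exp t * (t * exp t)) with (t ^ S n)
    by (simpl; field; lra).
  replace (INR (fact (S n)) * / t * (t * exp t))
    with (INR (fact (S n)) * exp t) by (field; lra).
  apply Rmult_le_reg_r with (/ INR (fact (S n))).
  - apply Rinv_0_lt_compat; auto.
  - replace (INR (fact (S n)) * exp t * / INR (fact (S n)))
      with (exp t) by (field; lra); exact H.
Qed.

Lemma is_lim_pow_exp (n : nat) :
  is_lim (fun t => t ^ n * exp (- t)) p_infty 0.
Proof.
  apply (is_lim_le_le_loc (fun _ => 0) (fun t => INR (fact (S n)) * / t)).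
  - exists 0; intros t Ht; split; [| apply pow_exp_le; auto].
    apply Rmult_le_pos; [apply pow_le; lra | apply Rlt_le, exp_pos].
  - apply is_lim_const.
  - replace (Finite 0) with (Rbar_mult (INR (fact (S n))) (Rbar_inv p_infty))
      by (simpl; f_equal; ring).
    apply is_lim_scal_l, is_lim_inv; [apply is_lim_id | discriminate].
Qed.

Lemma is_lim_gamma_primitive (n : nat) : is_lim (gamma_primitive n) p_infty 0.
Proof.
  induction n as [| n IH]; cbn [gamma_primitive].
  - assert (H := is_lim_opp _ _ _ (is_lim_pow_exp 0)); simpl in H.
    rewrite Ropp_0 in H; revert H; apply is_lim_ext; intros; ring.
  - assert (H := is_lim_minus' _ _ _ _ _
      (is_lim_scal_l _ (INR (S n)) _ _ IH) (is_lim_pow_exp (S n))).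
    replace (Finite 0) with (Finite (INR (S n) * 0 - 0)) by (f_equal; ring).
    exact H.
Qed.

Lemma Gamma_INR_S (n : nat) : Gamma (INR (S n)) = INR (fact n).
Proof.
  unfold Gamma; apply is_RInt_gen_unique.
  assert (HD : forall t, Derive (gamma_primitive n) t = t ^ n * exp (- t))
    by (intros; apply is_derive_unique, gamma_primitive_derive).
  apply (is_RInt_gen_ext (Derive (gamma_primitive n))).
  (* [Rpower t (INR n)] agrees with [t ^ n] for t > 0 only, so both endpoints are first made
     positive. *)
  - apply Filter_prod with (Q := fun x => 0 < x) (R := fun y => 0 < y).
    + exists (mkposreal 1 Rlt_0_1); auto.
    + exists 0; auto.
    + intros a b Ha Hb x [Hx _]; simpl in Hx.
      assert (0 < x) by (apply Rlt_trans with (2 := Hx); apply Rmin_case; auto).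
      rewrite HD, S_INR; replace (INR n + 1 - 1) with (INR n) by ring.
      rewrite Rpower_pow; auto.
  - replace (INR (fact n)) with (0 - (- INR (fact n))) by ring.
    apply is_RInt_gen_Derive.
    + apply filter_forall; intros _ x _; eexists; apply gamma_primitive_derive.
    + apply filter_forall; intros _ x _.
      apply (continuous_ext (fun t => t ^ n * exp (- t))); [auto |].
      apply (ex_derive_continuous (V := R_NormedModule)); auto_derive; auto.
    + rewrite <- gamma_primitive_0.
      apply (filterlim_filter_le_1 (G := at_right 0) (F := locally 0)).
      * apply filter_le_within.
      * apply (ex_derive_continuous (V := R_NormedModule)); eexists.
        apply gamma_primitive_derive.
    + exact (is_lim_gamma_primitive n).
Qed.

Lemma Pz_eq_Pz_deriv (lam : nat) (U : C -> Prop) (f : C -> C) (w : C) :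
  (1 <= lam)%nat -> @open C_UniformSpace U ->
  iter_partials (lam - 1) U f -> U w -> Pz lam f w = Pz_deriv lam f w.
Proof.
  intros Hlam HU Hf Hw; unfold Pz, Pz_deriv, P_op, P_op_deriv.
  destruct lam as [| m]; [lia |]; replace (S m - 1)%nat with m in * by lia.
  rewrite Gamma_INR_S, (euler_prod_wirtinger U); auto.
Qed.

Lemma P_op_1 (D : (C -> C) -> C -> C) (c f : C -> C) (w : C) :
  P_op D c 1 f w = f w.
Proof. unfold P_op; simpl; rewrite Rinv_1; ring. Qed.

(** * Wirtinger derivatives of power series *)

(** A quadratic error bound is what summing termwise estimates of a power series yields. *)
Lemma is_derive_quadratic (f : R -> R) (x l d K : R) :
  0 < d -> 0 <= K ->
  (forall h, Rabs h < d -> Rabs (f (x + h) - f x - h * l) <= K * h ^ 2) ->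
  is_derive f x l.
Proof.
  intros Hd HK H; apply is_derive_Reals; intros eps Heps.
  (* [K + 1] in place of [K] keeps the quotient meaningful when [K = 0]. *)
  assert (H0 : 0 < Rmin d (eps / (K + 1))).
  { apply Rmin_case; auto; apply Rdiv_lt_0_compat; lra. }
  exists (mkposreal _ H0); intros h Hh0 Hh; simpl in Hh.
  assert (Hh1 : Rabs h < d) by (eapply Rlt_le_trans; [exact Hh | apply Rmin_l]).
  assert (Hh2 : Rabs h < eps / (K + 1))
    by (eapply Rlt_le_trans; [exact Hh | apply Rmin_r]).
  assert (Hp : 0 < Rabs h) by (apply Rabs_pos_lt; auto).
  specialize (H h Hh1).
  replace ((f (x + h) - f x) / h - l) with ((f (x + h) - f x - h * l) / h)
    by (field; auto).
  unfold Rdiv; rewrite Rabs_mult, Rabs_inv.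
  apply Rmult_lt_reg_r with (Rabs h); auto.
  rewrite Rmult_assoc, Rinv_l, Rmult_1_r by lra.
  apply Rle_lt_trans with (1 := H); rewrite <- pow2_abs.
  apply Rmult_lt_compat_r with (r := K + 1) in Hh2; [| lra].
  unfold Rdiv in Hh2; rewrite Rmult_assoc, Rinv_l, Rmult_1_r in Hh2 by lra.
  simpl; nra.
Qed.

Lemma series_geom_bound (a : nat -> R) (K r : R) :
  0 <= r < 1 -> (forall n, Rabs (a n) <= K * r ^ n) ->
  ex_series a /\ Rabs (Series a) <= K / (1 - r).
Proof.
  intros Hr Ha.
  assert (Hg : is_series (fun n => K * r ^ n) (K / (1 - r))).
  { apply (is_series_scal K (fun n => r ^ n)), is_series_geom.
    rewrite Rabs_right; lra. }
  assert (Hx : ex_series (fun n => Rabs (a n))).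
  { apply (ex_series_le (V := R_CompleteNormedModule) _ (fun n => K * r ^ n)).
    - intros n; unfold norm; simpl; unfold abs; simpl.
      rewrite Rabs_Rabsolu; auto.
    - eexists; exact Hg. }
  split; [apply ex_series_Rabs; auto |].
  apply Rle_trans with (1 := Series_Rabs a Hx).
  rewrite <- (is_series_unique _ _ Hg); apply Series_le.
  - intros n; split; [apply Rabs_pos | auto].
  - eexists; exact Hg.
Qed.

Lemma im_le_Cmod (z : C) : Rabs (Im z) <= Cmod z.
Proof. apply Rle_trans with (2 := Rmax_Cmod z); apply Rmax_r. Qed.

(** Componentwise, to match [CSeries]; [is_series_RtoC] passes to convergence in the normed space at
    the end. *)
Definition is_cseries (a : nat -> C) (l : C) : Prop :=
  is_series (fun n => Re (a n)) (Re l) /\ is_series (fun n => Im (a n)) (Im l).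

Lemma is_cseries_unique (a : nat -> C) (l : C) :
  is_cseries a l -> CSeries a = l.
Proof.
  intros [H1 H2]; apply injective_projections; apply is_series_unique; auto.
Qed.

Lemma is_cseries_ext (a b : nat -> C) (l : C) :
  (forall n, a n = b n) -> is_cseries a l -> is_cseries b l.
Proof.
  intros H [H1 H2]; split; [revert H1 | revert H2]; apply is_series_ext;
    intros n; rewrite H; auto.
Qed.

Lemma cseries_geom_bound (a : nat -> C) (K r : R) :
  0 <= r < 1 -> (forall n, Cmod (a n) <= K * r ^ n) ->
  is_cseries a (CSeries a) /\
  Rabs (Re (CSeries a)) <= K / (1 - r) /\ Rabs (Im (CSeries a)) <= K / (1 - r).
Proof.
  intros Hr Ha.
  destruct (series_geom_bound (fun n => Re (a n)) K r Hr) as [H1 H2].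
  { intros n; apply Rle_trans with (2 := Ha n), re_le_Cmod. }
  destruct (series_geom_bound (fun n => Im (a n)) K r Hr) as [H3 H4].
  { intros n; apply Rle_trans with (2 := Ha n), im_le_Cmod. }
  split; [split; apply Series_correct | split]; auto.
Qed.

Lemma is_cseries_plus (a b : nat -> C) (l m : C) :
  is_cseries a l -> is_cseries b m ->
  is_cseries (fun n => (a n + b n)%C) (l + m)%C.
Proof.
  intros [H1 H2] [H3 H4]; split.
  - exact (is_series_plus _ _ _ _ H1 H3).
  - exact (is_series_plus _ _ _ _ H2 H4).
Qed.

Lemma is_cseries_scal (c : C) (a : nat -> C) (l : C) :
  is_cseries a l -> is_cseries (fun n => (c * a n)%C) (c * l)%C.
Proof.
  intros [H1 H2]; split.
  - exact (is_series_minus _ _ _ _ (is_series_scal (Re c) _ _ H1)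
      (is_series_scal (Im c) _ _ H2)).
  - exact (is_series_plus _ _ _ _ (is_series_scal (Re c) _ _ H2)
      (is_series_scal (Im c) _ _ H1)).
Qed.

Lemma is_cseries_conj (a : nat -> C) (l : C) :
  is_cseries a l -> is_cseries (fun n => Cconj (a n)) (Cconj l).
Proof.
  intros [H1 H2]; split; [exact H1 | exact (is_series_opp _ _ H2)].
Qed.

Lemma is_cseries_minus (a b : nat -> C) (l m : C) :
  is_cseries a l -> is_cseries b m ->
  is_cseries (fun n => (a n - b n)%C) (l - m)%C.
Proof.
  intros [H1 H2] [H3 H4]; split.
  - exact (is_series_minus _ _ _ _ H1 H3).
  - exact (is_series_minus _ _ _ _ H2 H4).
Qed.

(* The coefficient of h^p in (z + h)^N, that is C(N,p) z^(N-p). *)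
Fixpoint taylor_pow (z : C) (N p : nat) : C :=
  match N, p with
  | O, O => 1%C
  | O, S _ => 0%C
  | S N', O => (z * taylor_pow z N' O)%C
  | S N', S p' => (z * taylor_pow z N' (S p') + taylor_pow z N' p')%C
  end.

Lemma taylor_pow_0_r (z : C) (N : nat) : taylor_pow z N 0 = (z ^ N)%C.
Proof. induction N as [| N IH]; simpl; [| rewrite IH]; auto. Qed.

(* Cauchy's estimate for (z + h)^N on the circle |h| = e. *)
Lemma taylor_pow_bound (z : C) (r e : R) (N p : nat) :
  Cmod z <= r -> 0 < e ->
  Cmod (taylor_pow z N p) <= (r + e) ^ N * (/ e) ^ p.
Proof.
  intros Hz He; assert (Hr := Rle_trans _ _ _ (Cmod_ge_0 z) Hz).
  assert (Hi := Rinv_0_lt_compat _ He).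
  revert p; induction N as [| N IH]; intros p.
  - destruct p as [| p]; simpl.
    + rewrite Cmod_1; lra.
    + rewrite Cmod_0; assert (0 <= (/ e) ^ p) by (apply pow_le; lra); nra.
  - assert (HN : 0 <= (r + e) ^ N) by (apply pow_le; lra).
    destruct p as [| p]; cbn [taylor_pow].
    + rewrite Cmod_mult; apply Rle_trans with (r * ((r + e) ^ N * (/ e) ^ 0)).
      * apply Rmult_le_compat; auto using Cmod_ge_0.
      * simpl; nra.
    + eapply Rle_trans; [apply Cmod_triangle |]; rewrite Cmod_mult.
      apply Rle_trans with (r * ((r + e) ^ N * (/ e) ^ S p)
                            + (r + e) ^ N * (/ e) ^ p).
      * apply Rplus_le_compat; auto.
        apply Rmult_le_compat; auto using Cmod_ge_0.
      * right; simpl; field; lra.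
Qed.

(** The error of the first-order expansion in h of the p-th coefficient: the derivative of C(N,p)
    z^(N-p) is (p+1) C(N,p+1) z^(N-p-1). *)
Definition taylor_rem (z h : C) (N p : nat) : C :=
  (taylor_pow (z + h) N p - taylor_pow z N p
   - RtoC (INR (S p)) * h * taylor_pow z N (S p))%C.

Lemma taylor_rem_S_0 (z h : C) (N : nat) :
  taylor_rem z h (S N) 0 =
  ((z + h) * taylor_rem z h N 0 + h * h * taylor_pow z N 1)%C.
Proof. unfold taylor_rem; cbn [taylor_pow]; simpl INR; ring. Qed.

Lemma taylor_rem_S_S (z h : C) (N p : nat) :
  taylor_rem z h (S N) (S p) =
  ((z + h) * taylor_rem z h N (S p) + taylor_rem z h N p
   + RtoC (INR (S (S p))) * (h * h) * taylor_pow z N (S (S p)))%C.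
Proof.
  unfold taylor_rem; cbn [taylor_pow].
  rewrite (S_INR (S p)), RtoC_plus; ring.
Qed.

(** The second derivative of C(N,p) z^(N-p) is (p+1)(p+2) C(N,p+2) z^(N-p-2), and Cauchy's estimate
    for the binomial part gives (r+e)^N / e^(p+2); this explains the constant. In the induction on
    N, the summand r of the new factor r + e pays for the old remainder and the summand e for the
    fresh terms. The bound is geometric in N, hence summable once r + e < 1. *)
Lemma taylor_rem_bound (z h : C) (r e : R) (N p : nat) :
  Cmod z <= r -> Cmod (z + h) <= r -> 0 < e ->
  Cmod (taylor_rem z h N p) <=
  INR (S p) * INR (S (S p)) * (/ e) ^ S (S p) * (Cmod h ^ 2 * (r + e) ^ N).
Proof.
  intros Hz Hzh He; assert (Hr := Rle_trans _ _ _ (Cmod_ge_0 z) Hz).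
  assert (Hi := Rinv_0_lt_compat _ He).
  assert (Hei : / e * e = 1) by (apply Rinv_l; lra).
  assert (Hh : 0 <= Cmod h ^ 2) by (apply pow_le, Cmod_ge_0).
  revert p; induction N as [| N IH]; intros p.
  - replace (taylor_rem z h 0 p) with (RtoC 0)
      by (unfold taylor_rem; destruct p; simpl taylor_pow; ring).
    rewrite Cmod_0.
    apply Rmult_le_pos; [apply Rmult_le_pos; [apply Rmult_le_pos |] |
      rewrite Rmult_1_r; exact Hh]; auto using pos_INR, pow_le, Rlt_le.
  - assert (HN : 0 <= (r + e) ^ N) by (apply pow_le; lra).
    assert (HA : 0 <= Cmod h ^ 2 * (r + e) ^ N) by (apply Rmult_le_pos; auto).
    assert (Hmul : forall x y, Cmod x <= y ->
      Cmod ((z + h) * x)%C <= r * y).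
    { intros x y Hx; rewrite Cmod_mult.
      apply Rmult_le_compat; auto using Cmod_ge_0. }
    assert (Hsq : forall k : nat,
      Cmod (h * h * taylor_pow z N k)%C
      <= (/ e) ^ k * (Cmod h ^ 2 * (r + e) ^ N)).
    { intros k; assert (Hb := taylor_pow_bound z r e N k Hz He).
      rewrite !Cmod_mult; simpl in Hh |- *; nra. }
    set (A := Cmod h ^ 2 * (r + e) ^ N) in *.
    replace (Cmod h ^ 2 * (r + e) ^ S N) with ((r + e) * A)
      by (unfold A; simpl; ring).
    destruct p as [| p].
    + rewrite taylor_rem_S_0.
      eapply Rle_trans; [apply Cmod_triangle |].
      eapply Rle_trans.
      { apply Rplus_le_compat; [apply Hmul, IH | apply Hsq]. }
      replace (INR 1 * INR 2 * (/ e) ^ 2 * ((r + e) * A)) with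
        (r * (INR 1 * INR 2 * (/ e) ^ 2 * A) + 2 * (/ e * e) * / e * A)
        by (simpl; ring).
      rewrite Hei; simpl; nra.
    + rewrite taylor_rem_S_S.
      eapply Rle_trans; [apply Cmod_triangle |].
      eapply Rle_trans.
      { apply Rplus_le_compat; [eapply Rle_trans; [apply Cmod_triangle |];
          apply Rplus_le_compat; [apply Hmul, IH | apply IH] |].
        rewrite <- Cmult_assoc, Cmod_mult, Cmod_R, Rabs_right
          by (apply Rle_ge, pos_INR).
        apply Rmult_le_compat_l; [apply pos_INR | apply Hsq]. }
      set (B := (/ e) ^ S (S p) * A).
      assert (HB : 0 <= B) by (apply Rmult_le_pos; auto; apply pow_le; lra).
      replace (INR (S (S p)) * INR (S (S (S p))) * (/ e) ^ S (S (S p))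
        * ((r + e) * A)) with
        (r * (INR (S (S p)) * INR (S (S (S p))) * (/ e) ^ S (S (S p)) * A)
         + INR (S (S p)) * INR (S (S (S p))) * ((/ e * e) * B))
        by (unfold B; simpl pow; ring).
      rewrite Hei.
      replace (INR (S p) * INR (S (S p)) * (/ e) ^ S (S p) * A)
        with (INR (S p) * INR (S (S p)) * B) by (unfold B; ring).
      assert (Hp := pos_INR p); rewrite !S_INR; nra.
Qed.

(* The p-th Taylor coefficient at [z] of the power series with coefficients
   [beta]. *)
Definition taylor_series (beta : nat -> R) (p : nat) (z : C) : C :=
  CSeries (fun N => (RtoC (beta N) * taylor_pow z N p)%C).

Section TaylorSeries.

Variable beta : nat -> R.
Hypothesis Hbeta : forall N, Rabs (beta N) <= 1.

Lemma Cmod_beta (N : nat) (x : C) (M : R) :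
  Cmod x <= M -> Cmod (RtoC (beta N) * x)%C <= M.
Proof.
  intros Hx; rewrite Cmod_mult, Cmod_R.
  assert (H := Hbeta N); assert (H1 := Rabs_pos (beta N)).
  assert (H2 := Cmod_ge_0 x); nra.
Qed.

Lemma taylor_series_correct (p : nat) (z : C) :
  Cmod z < 1 ->
  is_cseries (fun N => (RtoC (beta N) * taylor_pow z N p)%C)
    (taylor_series beta p z).
Proof.
  intros Hz; assert (H0 := Cmod_ge_0 z).
  set (e := (1 - Cmod z) / 2).
  apply (cseries_geom_bound _ ((/ e) ^ p) (Cmod z + e)); [unfold e; lra |].
  intros N; apply Cmod_beta; rewrite Rmult_comm.
  apply taylor_pow_bound; unfold e; lra.
Qed.

Lemma taylor_series_remainder (p : nat) (w : C) :
  Cmod w < 1 -> exists d K, 0 < d /\ 0 <= K /\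
  forall h : C, Cmod h < d ->
    let l := (taylor_series beta p (w + h) - taylor_series beta p w
       - h * (RtoC (INR (S p)) * taylor_series beta (S p) w))%C in
    Rabs (Re l) <= K * Cmod h ^ 2 /\ Rabs (Im l) <= K * Cmod h ^ 2.
Proof.
  intros Hw; assert (H0 := Cmod_ge_0 w).
  (* A third of the distance to the circle: one [d] for the shift by [h], one for the radius in
     Cauchy's estimate, and |w| + 2 d is still below 1. *)
  set (d := (1 - Cmod w) / 3); assert (Hd : 0 < d) by (unfold d; lra).
  set (M := INR (S p) * INR (S (S p)) * (/ d) ^ S (S p)).
  assert (HM : 0 <= M).
  { apply Rmult_le_pos; [apply Rmult_le_pos |];
      auto using pos_INR, pow_le, Rlt_le, Rinv_0_lt_compat. }
  set (r := Cmod w + d).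
  assert (Hr : 0 <= r + d < 1) by (unfold r, d in *; lra).
  exists d, (M / (1 - (r + d))); split; [auto | split].
  { apply Rmult_le_pos; auto; apply Rlt_le, Rinv_0_lt_compat; lra. }
  intros h Hh.
  assert (Hwh : Cmod (w + h) <= r)
    by (apply Rle_trans with (1 := Cmod_triangle _ _); unfold r; lra).
  assert (HS : is_cseries (fun N => (RtoC (beta N) * taylor_rem w h N p)%C)
    (taylor_series beta p (w + h) - taylor_series beta p w
     - h * (RtoC (INR (S p)) * taylor_series beta (S p) w))%C).
  { assert (H1 : Cmod (w + h) < 1) by (unfold r, d in *; lra).
    assert (H := is_cseries_minus _ _ _ _
      (is_cseries_minus _ _ _ _ (taylor_series_correct p _ H1)
                                (taylor_series_correct p _ Hw))
      (is_cseries_scal h _ _ (is_cseries_scal (RtoC (INR (S p))) _ _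
         (taylor_series_correct (S p) _ Hw)))).
    revert H; apply is_cseries_ext; intros N; unfold taylor_rem; ring. }
  destruct (cseries_geom_bound (fun N => (RtoC (beta N) * taylor_rem w h N p)%C)
    (M * Cmod h ^ 2) (r + d) Hr) as [_ H].
  { intros N; apply Cmod_beta; rewrite Rmult_assoc.
    apply taylor_rem_bound; auto; unfold r; lra. }
  rewrite (is_cseries_unique _ _ HS) in H.
  replace (M / (1 - (r + d)) * Cmod h ^ 2) with (M * Cmod h ^ 2 / (1 - (r + d)))
    by (field; lra); exact H.
Qed.

(** The remainder bound holds for complex increments; real ones give the x-partial, multiples of i
    the y-partial. *)
Lemma is_partials_taylor_series (p : nat) (w : C) :
  Cmod w < 1 ->
  is_partials (taylor_series beta p) w
    (RtoC (INR (S p)) * taylor_series beta (S p) w)%C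
    (Ci * (RtoC (INR (S p)) * taylor_series beta (S p) w))%C.
Proof.
  intros Hw; destruct (taylor_series_remainder p w Hw) as (d & K & Hd & HK & H).
  set (L := (RtoC (INR (S p)) * taylor_series beta (S p) w)%C) in *.
  set (T := taylor_series beta p) in *; clearbody L T.
  destruct w as [x y].
  split; split; apply (is_derive_quadratic _ _ _ d K Hd HK); intros h Hh;
    unfold Re, Im; cbn [fst snd].
  - assert (E : Cmod (RtoC h) = Rabs h) by apply Cmod_R.
    destruct (H (RtoC h)) as [H1 _]; [rewrite E; auto |].
    rewrite E, pow2_abs in H1.
    replace ((x, y) + RtoC h)%C with (x + h, y) in H1
      by (apply injective_projections; simpl; ring).
    replace (h * fst L) with (fst (RtoC h * L)%C) by (simpl; ring); exact H1.
  - assert (E : Cmod (RtoC h) = Rabs h) by apply Cmod_R.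
    destruct (H (RtoC h)) as [_ H1]; [rewrite E; auto |].
    rewrite E, pow2_abs in H1.
    replace ((x, y) + RtoC h)%C with (x + h, y) in H1
      by (apply injective_projections; simpl; ring).
    replace (h * snd L) with (snd (RtoC h * L)%C) by (simpl; ring); exact H1.
  - assert (E : Cmod (RtoC h * Ci) = Rabs h)
      by (rewrite Cmod_mult, Cmod_R, Cmod_Ci; ring).
    destruct (H (RtoC h * Ci)%C) as [H1 _]; [rewrite E; auto |].
    rewrite E, pow2_abs in H1.
    replace ((x, y) + RtoC h * Ci)%C with (x, y + h) in H1
      by (apply injective_projections; simpl; ring).
    replace (h * fst (Ci * L)%C) with (fst (RtoC h * Ci * L)%C)
      by (simpl; ring); exact H1.
  - assert (E : Cmod (RtoC h * Ci) = Rabs h)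
      by (rewrite Cmod_mult, Cmod_R, Cmod_Ci; ring).
    destruct (H (RtoC h * Ci)%C) as [_ H1]; [rewrite E; auto |].
    rewrite E, pow2_abs in H1.
    replace ((x, y) + RtoC h * Ci)%C with (x, y + h) in H1
      by (apply injective_projections; simpl; ring).
    replace (h * snd (Ci * L)%C) with (snd (RtoC h * Ci * L)%C)
      by (simpl; ring); exact H1.
Qed.

End TaylorSeries.

(** * Residues *)

(* Let r(x) = f(x) / (x - w)^q with b k the k-th Taylor coefficient of f at z
   and d = z - w. Then [part_frac d b q p] is the residue at z of
   r(x) / (x - z)^p; the recursion is 1 = ((x - w) - (x - z)) / d. *)
Fixpoint part_frac (d : C) (b : nat -> C) (q : nat) : nat -> C :=
  match q with
  | O => fun p => match p with O => RtoC 0 | S p' => b p' end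
  | S q' => fix aux (p : nat) : C :=
      match p with
      | O => RtoC 0
      | S p' => ((part_frac d b q' (S p') - aux p') / d)%C
      end
  end.

Lemma part_frac_S_S (d : C) (b : nat -> C) (q p : nat) :
  part_frac d b (S q) (S p) =
  ((part_frac d b q (S p) - part_frac d b (S q) p) / d)%C.
Proof. reflexivity. Qed.

Lemma part_frac_0_r (d : C) (b : nat -> C) (q : nat) :
  part_frac d b q 0 = RtoC 0.
Proof. destruct q; reflexivity. Qed.

(** At a simple pole the residue is the value of the remaining factor. This recognises the function
    to be differentiated as a residue. *)
Lemma part_frac_1_r (d : C) (b : nat -> C) (q : nat) :
  d <> 0 -> part_frac d b q 1 = (b O * / d ^ q)%C.
Proof.
  intros Hd; induction q as [| q IH].
  - simpl; field.
  - rewrite part_frac_S_S, IH, part_frac_0_r; simpl Cpow.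
    field; split; auto; apply Cpow_nz; auto.
Qed.

(** For fixed orders [part_frac] is a finite linear expression in the Taylor coefficients, so it
    commutes with summation without any estimate. *)
Lemma is_cseries_part_frac (d : C) (a : nat -> R) (b : nat -> nat -> C)
    (l : nat -> C) :
  (forall p, is_cseries (fun N => (RtoC (a N) * b N p)%C) (l p)) ->
  forall q p, is_cseries (fun N => (RtoC (a N) * part_frac d (b N) q p)%C)
    (part_frac d l q p).
Proof.
  intros Hb.
  assert (H0 : is_cseries (fun N => (RtoC (a N) * RtoC 0)%C) (RtoC 0)).
  { assert (H := is_cseries_scal (RtoC 0) _ _ (Hb O)).
    rewrite Cmult_0_l in H; revert H.
    apply is_cseries_ext; intros; ring. }
  induction q as [| q IHq].
  - intros [| p]; [exact H0 | apply Hb].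
  - induction p as [| p IHp]; [exact H0 |].
    rewrite part_frac_S_S.
    replace ((part_frac d l q (S p) - part_frac d l (S q) p) / d)%C
      with (/ d * (part_frac d l q (S p) - part_frac d l (S q) p))%C
      by (unfold Cdiv; ring).
    apply is_cseries_ext with (2 := is_cseries_scal (/ d)%C _ _
      (is_cseries_minus _ _ _ _ (IHq (S p)) IHp)).
    intros N; rewrite part_frac_S_S; unfold Cdiv; ring.
Qed.

Definition slit_disk (w : C) : Prop := Cmod w < 1 /\ (w - Cconj w)%C <> 0.

Lemma minus_conj_neq_0 (w : C) : w <> Cconj w -> (w - Cconj w)%C <> 0.
Proof.
  intros H E; apply H; replace w with (w - Cconj w + Cconj w)%C at 1 by ring.
  rewrite E; ring.
Qed.

Lemma open_unit_disk : @open C_UniformSpace (fun w : C => Cmod w < 1).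
Proof.
  (* Balls of [C] are squares, and [Cmod] is at most sqrt 2 < 2 times the maximum norm; hence half
     the distance to the circle. *)
  intros z Hz; assert (Hd : 0 < (1 - Cmod z) / 2) by lra.
  exists (mkposreal _ Hd); intros w [H1 H2].
  change (Rabs (fst w - fst z) < (1 - Cmod z) / 2) in H1.
  change (Rabs (snd w - snd z) < (1 - Cmod z) / 2) in H2.
  assert (H := Cmod_2Rmax (w - z)%C).
  assert (Hm : Rmax (Rabs (fst (w - z)%C)) (Rabs (snd (w - z)%C))
    < (1 - Cmod z) / 2) by (apply Rmax_case; [exact H1 | exact H2]).
  assert (H0 := Rmax_l (Rabs (fst (w - z)%C)) (Rabs (snd (w - z)%C))).
  assert (H0' := Rabs_pos (fst (w - z)%C)).
  assert (Hs : sqrt 2 < 2) by (apply sqrt_less; lra).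
  assert (Ht := Cmod_triangle z (w - z)).
  assert (E : forall a b : C, (a + (b - a))%C = b) by (intros; ring).
  rewrite E in Ht.
  nra.
Qed.

Lemma open_slit_disk : @open C_UniformSpace slit_disk.
Proof.
  apply (@open_and C_UniformSpace); [apply open_unit_disk |].
  (* w - conj w = 2 i Im w, so the condition is that Im w is nonzero. *)
  apply (open_ext (T := C_UniformSpace) (fun w : C => snd w <> 0)).
  - intros [x y]; split; simpl; intros H E; apply H.
    + injection E; intros; lra.
    + apply injective_projections; simpl; lra.
  - apply (open_comp (T := C_UniformSpace) (U := R_UniformSpace)
      (fun w : C => snd w) (fun t => t <> 0)); [| apply open_neq].
    intros [x y] _.
    apply (continuous_snd (U := R_UniformSpace) (V := R_UniformSpace)).
Qed.

Lemma is_partials_minus_conj (w : C) :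
  is_partials (fun v => (v - Cconj v)%C) w (RtoC 0) (2 * Ci)%C.
Proof.
  assert (H := is_partials_plus _ _ _ _ _ _ _ (is_partials_id w)
    (is_partials_mult _ _ _ _ _ _ _ (is_partials_const (RtoC (-1)) w)
       (is_partials_conj _ _ _ _ (is_partials_id w)))).
  revert H; cbv beta.
  replace (fun v => (v + RtoC (-1) * Cconj v)%C) with (fun v => (v - Cconj v)%C)
    by (apply functional_extensionality; intros; ring).
  replace (1 + (0 * Cconj w + RtoC (-1) * Cconj 1))%C with (RtoC 0)
    by (apply injective_projections; simpl; ring).
  replace (Ci + (0 * Cconj w + RtoC (-1) * Cconj Ci))%C with (2 * Ci)%C
    by (apply injective_projections; simpl; ring).
  auto.
Qed.

Lemma wirtinger_minus_conj (w : C) :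
  wirtinger (fun v => (v - Cconj v)%C) w = RtoC 1.
Proof.
  rewrite (wirtinger_is_partials _ _ _ _ (is_partials_minus_conj w)).
  apply injective_projections; simpl; field.
Qed.

Lemma wirtinger_inv (f : C -> C) (w : C) :
  f w <> 0 -> ex_partials f w ->
  wirtinger (fun v => (/ f v)%C) w = (- wirtinger f w / (f w * f w))%C.
Proof.
  intros H0 Hf%ex_partials_correct.
  rewrite (wirtinger_is_partials _ _ _ _ (is_partials_inv _ _ _ _ H0 Hf)).
  unfold wirtinger; field; auto.
Qed.

Lemma wirtinger_minus (f g : C -> C) (w : C) :
  ex_partials f w -> ex_partials g w ->
  wirtinger (fun v => (f v - g v)%C) w = (wirtinger f w - wirtinger g w)%C.
Proof.
  intros Hf%ex_partials_correct Hg%ex_partials_correct.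
  assert (H := wirtinger_is_partials _ _ _ _ (is_partials_plus _ _ _ _ _ _ _ Hf
    (is_partials_mult _ _ _ _ _ _ _ (is_partials_const (RtoC (-1)) w) Hg))).
  replace (fun v => (f v - g v)%C) with (fun v => (f v + RtoC (-1) * g v)%C)
    by (apply functional_extensionality; intros; ring).
  cbv beta in H; rewrite H; unfold wirtinger; ring.
Qed.

Section Residue.

Variable beta : nat -> R.
Hypothesis Hbeta : forall N, Rabs (beta N) <= 1.

(** With g the power series with coefficients [beta], this is the residue at x = w of g(x) / ((x -
    w)^p (x - conj w)^q). *)
Definition residue (q p : nat) (w : C) : C :=
  part_frac (w - Cconj w) (fun k => taylor_series beta k w) q p.

Lemma iter_partials_taylor_series (k p : nat) :
  iter_partials k slit_disk (taylor_series beta p).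
Proof.
  revert p; induction k as [| k IH]; intros p; [exact I |].
  eapply (iter_partials_intro _ open_slit_disk).
  - intros w [Hw _]; exact (is_partials_taylor_series beta Hbeta p w Hw).
  - apply iter_partials_mult; auto using open_slit_disk, iter_partials_const.
  - repeat apply iter_partials_mult;
      auto using open_slit_disk, iter_partials_const.
Qed.

Lemma iter_partials_minus_conj (k : nat) :
  iter_partials k slit_disk (fun w => (w - Cconj w)%C).
Proof.
  destruct k as [| k]; [exact I |].
  eapply (iter_partials_intro _ open_slit_disk);
    [intros; apply is_partials_minus_conj | |];
    apply iter_partials_const, open_slit_disk.
Qed.

Lemma iter_partials_inv_minus_conj (k : nat) :
  iter_partials k slit_disk (fun w => (/ (w - Cconj w))%C).
Proof.
  apply (iter_partials_inv _ open_slit_disk); [intros w [_ H]; exact H |].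
  apply iter_partials_minus_conj.
Qed.

Lemma iter_partials_residue (k q p : nat) :
  iter_partials k slit_disk (residue q p).
Proof.
  revert p; induction q as [| q IHq].
  - intros [| p]; [exact (iter_partials_const _ open_slit_disk k (RtoC 0)) |].
    apply iter_partials_taylor_series.
  - induction p as [| p IHp]; [exact (iter_partials_const _ open_slit_disk k (RtoC 0)) |].
    apply (iter_partials_ext _ open_slit_disk _ (fun w =>
      ((residue q (S p) w + RtoC (-1) * residue (S q) p w)
       * / (w - Cconj w))%C)).
    + intros w _; unfold residue; rewrite part_frac_S_S; unfold Cdiv; ring.
    + apply iter_partials_mult, iter_partials_inv_minus_conj;
        [apply open_slit_disk |].
      apply iter_partials_plus; auto using open_slit_disk.
      apply iter_partials_mult; auto using open_slit_disk, iter_partials_const.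
Qed.

Lemma ex_partials_residue (q p : nat) (w : C) :
  slit_disk w -> ex_partials (residue q p) w.
Proof. apply (iter_partials_residue 1 q p). Qed.

(** D moves the pole w and keeps conj w fixed, and the derivative of (x - w)^(-p) in w is p (x -
    w)^(-p-1). The proof follows the recursion of [part_frac], using D(w - conj w) = 1. *)
Lemma wirtinger_residue (q p : nat) (w : C) :
  slit_disk w ->
  wirtinger (residue q p) w = (RtoC (INR p) * residue q (S p) w)%C.
Proof.
  intros Hw; revert p.
  assert (Hz : wirtinger (fun _ => RtoC 0) w = RtoC 0).
  { rewrite (wirtinger_is_partials _ _ _ _ (is_partials_const _ w)); ring. }
  induction q as [| q IHq].
  - intros [| p].
    + change (residue 0 0) with (fun _ : C => RtoC 0); rewrite Hz; simpl; ring.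
    + change (residue 0 (S p)) with (taylor_series beta p).
      change (residue 0 (S (S p)) w) with (taylor_series beta (S p) w).
      rewrite (wirtinger_is_partials _ _ _ _
        (is_partials_taylor_series beta Hbeta p w (proj1 Hw))).
      apply wirtinger_holomorphic.
  - induction p as [| p IHp].
    + change (residue (S q) 0) with (fun _ : C => RtoC 0); rewrite Hz; simpl; ring.
    + assert (Hd := proj2 Hw).
      change (residue (S q) (S p)) with (fun v =>
        ((residue q (S p) v - residue (S q) p v) * / (v - Cconj v))%C).
      rewrite wirtinger_mult.
      * rewrite wirtinger_minus, IHq, IHp by (apply ex_partials_residue; auto).
        rewrite wirtinger_inv, wirtinger_minus_conj; auto.
        -- change (residue (S q) (S (S p)) w) with
             ((residue q (S (S p)) w - (residue q (S p) w - residue (S q) p w)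
                / (w - Cconj w)) / (w - Cconj w))%C.
           change (residue (S q) (S p) w) with
             ((residue q (S p) w - residue (S q) p w) / (w - Cconj w))%C.
           rewrite S_INR, RtoC_plus; field; auto.
        -- eapply is_partials_ex, is_partials_minus_conj.
      * apply (iter_partials_ext _ open_slit_disk 1 (fun v =>
          (residue q (S p) v + RtoC (-1) * residue (S q) p v)%C)); auto.
        -- intros; ring.
        -- apply iter_partials_plus, iter_partials_mult;
             auto using open_slit_disk, iter_partials_const,
               iter_partials_residue.
      * apply (iter_partials_inv_minus_conj 1); auto.
Qed.

(** The factorial that builds up here cancels the 1 / (lam - 1)! of [P_op]. *)
Lemma wirtinger_iter_residue (q m : nat) (w : C) :
  slit_disk w ->
  Nat.iter m wirtinger (residue q 1) w =
  (RtoC (INR (fact m)) * residue q (S m) w)%C.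
Proof.
  revert w; induction m as [| m IH]; intros w Hw.
  - simpl; ring.
  - cbn [Nat.iter nat_rect].
    change (wirtinger (Nat.iter m wirtinger (residue q 1)) w =
      (RtoC (INR (fact (S m))) * residue q (S (S m)) w)%C).
    rewrite (wirtinger_ext slit_disk _ (fun v =>
      (RtoC (INR (fact m)) * residue q (S m) v)%C) w open_slit_disk); auto.
    rewrite wirtinger_mult.
    + rewrite (wirtinger_is_partials _ _ _ _ (is_partials_const _ w)).
      rewrite wirtinger_residue by auto.
      rewrite fact_simpl, mult_INR, RtoC_mult; ring.
    + eapply is_partials_ex, is_partials_const.
    + apply ex_partials_residue; auto.
Qed.

End Residue.

(* Coefficients of x^m Li_s(x). *)
Definition polylog_coef (s m N : nat) : R :=
  if (N <=? m)%nat then 0 else / INR (N - m) ^ s.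

Lemma polylog_coef_bound (s m N : nat) : Rabs (polylog_coef s m N) <= 1.
Proof.
  unfold polylog_coef; destruct (Nat.leb_spec N m) as [H | H].
  - rewrite Rabs_R0; lra.
  - assert (H1 : 1 <= INR (N - m)) by (apply (le_INR 1); lia).
    assert (H2 : 1 <= INR (N - m) ^ s) by (apply pow_R1_Rle; auto).
    rewrite Rabs_right.
    + rewrite <- Rinv_1; apply Rinv_le_contravar; lra.
    + apply Rle_ge, Rlt_le, Rinv_0_lt_compat; lra.
Qed.

Lemma polylog_coef_shift (s m n : nat) :
  polylog_coef s m (S m + n) = / INR (S n) ^ s.
Proof.
  unfold polylog_coef; destruct (Nat.leb_spec (S m + n) m); [lia |].
  do 3 f_equal; lia.
Qed.

Lemma is_series_shift (a : nat -> R) (k : nat) (l : R) :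
  (forall n, (n < k)%nat -> a n = 0) ->
  is_series a l -> is_series (fun n => a (k + n)%nat) l.
Proof.
  revert a; induction k as [| k IH]; intros a H0 Ha; [exact Ha |].
  apply (IH (fun n => a (S n))).
  - intros n Hn; apply H0; lia.
  - apply is_series_incr_1; rewrite (H0 O) by lia.
    unfold plus; simpl; rewrite Rplus_0_r; exact Ha.
Qed.

Lemma is_cseries_shift (a : nat -> C) (k : nat) (l : C) :
  (forall n, (n < k)%nat -> a n = RtoC 0) ->
  is_cseries a l -> is_cseries (fun n => a (k + n)%nat) l.
Proof.
  intros H0 [H1 H2]; split;
    [apply (is_series_shift (fun n => Re (a n)))
    | apply (is_series_shift (fun n => Im (a n)))]; auto;
    intros n Hn; rewrite H0; auto.
Qed.

Lemma is_cseries_polylog (s m : nat) (w : C) :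
  Cmod w < 1 ->
  is_cseries (fun n => (w ^ m * (w ^ S n / RtoC (INR (S n) ^ s)))%C)
    (taylor_series (polylog_coef s m) 0 w).
Proof.
  intros Hw.
  assert (H := taylor_series_correct _ (polylog_coef_bound s m) 0 w Hw).
  apply (is_cseries_shift _ (S m)) in H.
  - revert H; apply is_cseries_ext; intros n.
    rewrite polylog_coef_shift, taylor_pow_0_r.
    assert (Hn : INR (S n) ^ s <> 0)
      by (apply pow_nonzero; apply not_0_INR; lia).
    rewrite RtoC_inv by auto.
    replace (S m + n)%nat with (m + S n)%nat by lia; rewrite Cpow_add_r.
    unfold Cdiv; ring.
  - intros n Hn; unfold polylog_coef.
    destruct (Nat.leb_spec n m); [ring | lia].
Qed.

Lemma polylog_taylor_series (s : nat) (w : C) :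
  Cmod w < 1 -> polylog s w = taylor_series (polylog_coef s 0) 0 w.
Proof.
  intros Hw; apply is_cseries_unique.
  apply is_cseries_ext with (2 := is_cseries_polylog s 0 w Hw).
  intros n; simpl Cpow; ring.
Qed.

Lemma pow_mult_polylog (s m : nat) (w : C) :
  Cmod w < 1 ->
  (w ^ m * polylog s w)%C = taylor_series (polylog_coef s m) 0 w.
Proof.
  intros Hw; rewrite <- (is_cseries_unique _ _ (is_cseries_polylog s m w Hw)).
  symmetry; apply is_cseries_unique, is_cseries_scal.
  rewrite polylog_taylor_series by auto.
  apply is_cseries_ext with (2 := is_cseries_polylog s 0 w Hw).
  intros n; simpl Cpow; ring.
Qed.

(** w^m Li_s(w) / d^(m+1) is the residue with pole orders m + 1 at conj w and 1 at w; the m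
    derivatives make both orders equal to m + 1. *)
Lemma Pz_polylog (m s : nat) (z : C) :
  slit_disk z ->
  Pz (S m) (fun w => polylog s w / Cpow (w - Cconj w) (S m))%C z =
  residue (polylog_coef s m) (S m) (S m) z.
Proof.
  intros Hz; unfold Pz, P_op; replace (S m - 1)%nat with m by lia.
  rewrite (euler_prod_wirtinger _ open_slit_disk); auto.
  - rewrite (wirtinger_iter_ext _ open_slit_disk m _
      (residue (polylog_coef s m) (S m) 1)); auto.
    + rewrite wirtinger_iter_residue by auto using polylog_coef_bound.
      rewrite RtoC_inv by apply INR_fact_neq_0.
      field; intros E; apply (INR_fact_neq_0 m), RtoC_inj, E.
    + intros w [Hw Hd]; unfold residue.
      rewrite part_frac_1_r, <- pow_mult_polylog by auto; unfold Cdiv; ring.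
  (* The smoothness that [euler_prod_wirtinger] asks of the function under the operator. *)
  - apply (iter_partials_ext _ open_slit_disk _ (fun w =>
      (taylor_series (polylog_coef s 0) 0 w * (/ (w - Cconj w)) ^ S m)%C)).
    + intros w [Hw Hd]; rewrite polylog_taylor_series, Cpow_inv; auto.
    + apply iter_partials_mult, iter_partials_pow; auto using open_slit_disk,
        iter_partials_inv_minus_conj, iter_partials_taylor_series,
        polylog_coef_bound.
Qed.

(** * Gegenbauer polynomials *)

(* Coefficients of (1 - t u + m u^2)^(-l) in powers of u, obtained by solving
   (1 - t u + m u^2) A_(l+1) = A_l degree by degree. *)
Fixpoint quad_coef (t m : R) (l : nat) : nat -> R :=
  match l with
  | O => fun n => match n with O => 1 | S _ => 0 end
  | S l' => fix aux (n : nat) : R :=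
      match n with
      | O => quad_coef t m l' O
      | S n' => quad_coef t m l' n + t * aux n'
          - m * match n' with O => 0 | S n'' => aux n'' end
      end
  end.

Lemma quad_coef_S_0 (t m : R) (l : nat) :
  quad_coef t m (S l) 0 = quad_coef t m l 0.
Proof. reflexivity. Qed.

Lemma quad_coef_S_1 (t m : R) (l : nat) :
  quad_coef t m (S l) 1 = quad_coef t m l 1 + t * quad_coef t m (S l) 0.
Proof. simpl; ring. Qed.

Lemma quad_coef_S_SS (t m : R) (l n : nat) :
  quad_coef t m (S l) (S (S n)) =
  quad_coef t m l (S (S n)) + t * quad_coef t m (S l) (S n)
  - m * quad_coef t m (S l) n.
Proof. reflexivity. Qed.

Lemma nat_ind2 (P : nat -> Prop) :
  P O -> P 1%nat -> (forall n, P n -> P (S n) -> P (S (S n))) ->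
  forall n, P n.
Proof.
  intros H0 H1 HS n; cut (P n /\ P (S n)); [tauto |].
  induction n as [| n [IH1 IH2]]; auto.
Qed.

(** Substitution of r u for u in the generating function. *)
Lemma quad_coef_scal (t m r : R) (l n : nat) :
  quad_coef (r * t) (r ^ 2 * m) l n = r ^ n * quad_coef t m l n.
Proof.
  revert n; induction l as [| l IHl].
  - intros [| n]; simpl; ring.
  - apply nat_ind2.
    + rewrite !quad_coef_S_0, IHl; reflexivity.
    + rewrite !quad_coef_S_1, !quad_coef_S_0, !IHl; ring.
    + intros n H1 H2; rewrite !quad_coef_S_SS, IHl, H1, H2; simpl; ring.
Qed.

(** Half of 2^(l+1) K^n covers the coefficient of the level below, the other half the two terms fed
    back from the same level; the latter needs 2|t|K + 2|m| <= K^2, which the factor 4 secures. Some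
    positive radius of convergence is all that is wanted. *)
Lemma quad_coef_bound (t m K : R) (l n : nat) :
  4 * (1 + Rabs t + Rabs m) <= K ->
  Rabs (quad_coef t m l n) <= 2 ^ l * K ^ n.
Proof.
  intros HK; assert (Ht := Rabs_pos t); assert (Hm := Rabs_pos m).
  revert n; induction l as [| l IHl].
  - intros n; assert (0 <= K ^ n) by (apply pow_le; lra).
    destruct n as [| n]; simpl in *;
      [rewrite Rabs_R1 | rewrite Rabs_R0]; lra.
  - assert (H2 : 0 < 2 ^ l) by (apply pow_lt; lra).
    apply nat_ind2.
    + rewrite quad_coef_S_0; specialize (IHl O); simpl in *; lra.
    + rewrite quad_coef_S_1, quad_coef_S_0.
      eapply Rle_trans; [apply Rabs_triang |]; rewrite Rabs_mult.
      assert (H0 := IHl O); assert (H1 := IHl 1%nat); simpl in *.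
      assert (Rabs t * Rabs (quad_coef t m l 0) <= Rabs t * 2 ^ l)
        by (apply Rmult_le_compat_l; lra).
      nra.
    + intros n H0 H1; rewrite quad_coef_S_SS.
      assert (HKn : 0 < K ^ n) by (apply pow_lt; lra).
      assert (H := IHl (S (S n))).
      assert (Rabs t * Rabs (quad_coef t m (S l) (S n))
        <= Rabs t * (2 ^ S l * K ^ S n)) by (apply Rmult_le_compat_l; lra).
      assert (Rabs m * Rabs (quad_coef t m (S l) n)
        <= Rabs m * (2 ^ S l * K ^ n)) by (apply Rmult_le_compat_l; lra).
      unfold Rminus; eapply Rle_trans; [apply Rabs_triang |].
      rewrite Rabs_Ropp, Rabs_mult.
      eapply Rle_trans;
        [apply Rplus_le_compat_r, Rabs_triang |]; rewrite Rabs_mult.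
      assert (HX : 0 < 2 ^ l * K ^ n) by (apply Rmult_lt_0_compat; auto).
      cbn [pow] in *.
      set (X := 2 ^ l * K ^ n) in *.
      replace (2 ^ l * (K * (K * K ^ n))) with (X * (K * K)) in H
        by (unfold X; ring).
      replace (2 * 2 ^ l * (K * (K * K ^ n))) with (2 * (X * (K * K)))
        by (unfold X; ring).
      replace (Rabs t * (2 * 2 ^ l * (K * K ^ n))) with (X * (2 * Rabs t * K))
        in * by (unfold X; ring).
      replace (Rabs m * (2 * 2 ^ l * K ^ n)) with (X * (2 * Rabs m))
        in * by (unfold X; ring).
      assert (2 * Rabs t * K + 2 * Rabs m <= K * K) by nra.
      assert (X * (2 * Rabs t * K + 2 * Rabs m) <= X * (K * K))
        by (apply Rmult_le_compat_l; lra).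
      lra.
Qed.

Lemma quad_coef_term_bound (t m K x : R) (l n : nat) :
  4 * (1 + Rabs t + Rabs m) <= K ->
  Rabs (quad_coef t m l n * x ^ n) <= 2 ^ l * (Rabs x * K) ^ n.
Proof.
  intros HK; rewrite Rabs_mult, <- RPow_abs, Rpow_mult_distr.
  assert (H := quad_coef_bound t m K l n HK).
  assert (H0 : 0 <= Rabs x ^ n) by (apply pow_le, Rabs_pos).
  nra.
Qed.

Lemma CV_disk_quad_coef (t m K x : R) (l : nat) :
  4 * (1 + Rabs t + Rabs m) <= K -> Rabs x * K < 1 ->
  CV_disk (quad_coef t m l) x.
Proof.
  intros HK Hx; assert (Ht := Rabs_pos t); assert (Hm := Rabs_pos m).
  apply (series_geom_bound (fun n => Rabs (quad_coef t m l n * x ^ n))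
    (2 ^ l) (Rabs x * K)).
  - split; auto; apply Rmult_le_pos; [apply Rabs_pos | lra].
  - intros n; rewrite Rabs_Rabsolu; apply quad_coef_term_bound; auto.
Qed.

Lemma PSeries_quad_coef_S (t m K x : R) (l : nat) :
  4 * (1 + Rabs t + Rabs m) <= K -> Rabs x * K < 1 ->
  PSeries (quad_coef t m l) x =
  (1 - t * x + m * x ^ 2) * PSeries (quad_coef t m (S l)) x.
Proof.
  intros HK Hx; set (a := quad_coef t m (S l)).
  assert (Ha : ex_pseries a x)
    by (apply CV_disk_correct; eapply CV_disk_quad_coef; eauto).
  assert (H1 := ex_pseries_incr_1 a x Ha).
  assert (H2 := ex_pseries_incr_1 _ x H1).
  rewrite (PSeries_ext _ (PS_plus a (PS_plus (PS_scal (- t) (PS_incr_1 a))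
    (PS_scal m (PS_incr_1 (PS_incr_1 a)))))).
  - rewrite !PSeries_plus, !PSeries_scal, !PSeries_incr_1.
    + simpl; ring.
    + apply ex_pseries_scal; [apply Rmult_comm | auto].
    + apply ex_pseries_scal; [apply Rmult_comm | auto].
    + auto.
    + apply ex_pseries_plus; apply ex_pseries_scal; auto; apply Rmult_comm.
  - intros [| [| n]].
    + change (quad_coef t m l 0 = a O + (- t * 0 + m * 0)).
      unfold a; rewrite quad_coef_S_0; ring.
    + change (quad_coef t m l 1 = a 1%nat + (- t * a O + m * 0)).
      unfold a; rewrite quad_coef_S_1; ring.
    + change (quad_coef t m l (S (S n)) =
        a (S (S n)) + (- t * a (S n) + m * a n)).
      unfold a; rewrite quad_coef_S_SS; ring.
Qed.

Lemma PSeries_quad_coef (t m K x : R) (l : nat) :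
  4 * (1 + Rabs t + Rabs m) <= K -> Rabs x * K < 1 ->
  PSeries (quad_coef t m l) x = / (1 - t * x + m * x ^ 2) ^ l.
Proof.
  intros HK Hx.
  assert (H0 : PSeries (quad_coef t m 0) x = 1).
  { apply is_series_unique.
    apply (is_series_ext (fun n => match n with O => 1 | S _ => 0 end)).
    - intros [| n]; simpl; ring.
    - apply is_series_decr_1; simpl.
      match goal with |- is_series _ ?v => replace v with 0 end.
      2:{ unfold plus, opp; simpl; ring. }
      apply filterlim_ext with (fun _ : nat => 0); [| apply filterlim_const].
      intros n; symmetry; exact (sum_n_m_const_zero 0 n). }
  (* At a zero of the quadratic, the recursion from level 0 to level 1 would read 1 = 0. *)
  assert (Hn : 1 - t * x + m * x ^ 2 <> 0).
  { intros E; assert (H := PSeries_quad_coef_S t m K x 0 HK Hx).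
    rewrite E, H0 in H; lra. }
  induction l as [| l IH].
  - rewrite H0; simpl; field.
  - rewrite (PSeries_quad_coef_S t m K x l HK Hx) in IH.
    apply Rmult_eq_reg_l with (1 - t * x + m * x ^ 2); auto.
    rewrite IH; set (y := 1 - t * x + m * x ^ 2) in *; clearbody y.
    cbn [pow]; field; split; auto; apply pow_nonzero; auto.
Qed.

(** Derivatives at 0 depend only on the function near 0, where it is the sum of the power series. *)
Lemma gegenbauer_quad_coef (lam n : nat) (r : R) :
  gegenbauer lam n r = quad_coef (2 * r) 1 lam n.
Proof.
  unfold gegenbauer.
  set (K := 4 * (1 + Rabs (2 * r) + Rabs 1)).
  assert (HK : 4 <= K).
  { assert (Ha := Rabs_pos (2 * r)); assert (Hb := Rabs_pos 1).
    unfold K; lra. }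
  (* Within radius 1 / (2 K) the coefficient bound becomes geometric of ratio at most 1/2. *)
  assert (Hi : 0 < / (2 * K)) by (apply Rinv_0_lt_compat; lra).
  assert (Hx : forall x, Rabs x <= / (2 * K) -> Rabs x * K < 1).
  { intros x Hx; apply Rle_lt_trans with (/ (2 * K) * K).
    - apply Rmult_le_compat_r; lra.
    - replace (/ (2 * K) * K) with (/ 2) by (field; lra); lra. }
  rewrite (Derive_n_ext_loc _ (PSeries (quad_coef (2 * r) 1 lam))).
  - rewrite Derive_n_coef; [field; apply INR_fact_neq_0 |].
    apply Rbar_lt_le_trans with (Finite (/ (2 * K))); [exact Hi |].
    apply (proj1 (CV_radius_bounded _)); exists (2 ^ lam); intros n'.
    eapply Rle_trans; [apply (quad_coef_term_bound _ _ K); unfold K; lra |].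
    rewrite Rabs_right by lra.
    replace (/ (2 * K) * K) with (/ 2) by (field; lra).
    assert (0 < 2 ^ lam) by (apply pow_lt; lra).
    assert ((/ 2) ^ n' <= 1 ^ n') by (apply pow_incr; lra).
    rewrite pow1 in *; nra.
  - exists (mkposreal _ Hi); intros x Hb.
    change (Rabs (x - 0) < / (2 * K)) in Hb; rewrite Rminus_0_r in Hb.
    rewrite (PSeries_quad_coef _ _ K) by (auto using Rle_refl, Rlt_le).
    rewrite Rmult_1_l; reflexivity.
Qed.

(** Scaling by |z| absorbs the factor |z|^n and clears the quotient Re z / |z|, leaving parameters
    polynomial in Re z and Im z. *)
Lemma sigma_term_quad_coef (lam s : nat) (z : C) (n : nat) :
  z <> 0 ->
  sigma_term lam s z n =
  quad_coef (2 * Re z) (Cmod z ^ 2) lam n * / INR (lam + n) ^ s.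
Proof.
  intros Hz; unfold sigma_term; f_equal.
  assert (Hp : 0 < Cmod z) by (apply Cmod_gt_0; auto).
  assert (E : Re (z * Cconj z)%C = Cmod z ^ 2) by (rewrite <- Cmod2_conj; reflexivity).
  rewrite E, gegenbauer_quad_coef.
  assert (Es : sqrt (Cmod z ^ 2) = Cmod z) by (apply sqrt_pow2; lra).
  rewrite Es.
  replace (Rpower (Cmod z ^ 2) (INR n / 2)) with (Cmod z ^ n).
  - replace (2 * (Re (z + Cconj z)%C / (2 * Cmod z)))
      with (2 * Re z / Cmod z)
      by (unfold Re; simpl; field; lra).
    rewrite Rmult_comm, <- quad_coef_scal; f_equal; [field; lra | ring].
  - rewrite <- (Rpower_pow 2), Rpower_mult by auto.
    rewrite <- (Rpower_pow n) by auto; f_equal; simpl; field.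
Qed.

(** * Sum of the residues at the two conjugate poles *)

Section ResidueSum.

Variable z : C.
Hypothesis Hd : (z - Cconj z)%C <> 0.

(** The residue at x = z of x^N / ((x - z)^p (x - conj z)^q). *)
Definition pow_residue (q p N : nat) : C :=
  part_frac (z - Cconj z) (taylor_pow z N) q p.

Lemma pow_residue_S_S (q p N : nat) :
  pow_residue (S q) (S p) N =
  ((pow_residue q (S p) N - pow_residue (S q) p N) / (z - Cconj z))%C.
Proof. reflexivity. Qed.

Lemma pow_residue_0_r (q N : nat) : pow_residue q 0 N = RtoC 0.
Proof. apply part_frac_0_r. Qed.

(** x^(N+1) = z x^N + (x - z) x^N, and the factor x - z lowers the order at z. *)
Lemma pow_residue_succ_l (q p N : nat) :
  pow_residue q (S p) (S N) = (z * pow_residue q (S p) N + pow_residue q p N)%C.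
Proof.
  revert p; induction q as [| q IHq].
  - intros [| p]; unfold pow_residue; simpl; ring.
  - induction p as [| p IHp].
    + rewrite !pow_residue_S_S, IHq, !pow_residue_0_r; field; auto.
    + rewrite (pow_residue_S_S q (S p) (S N)), (pow_residue_S_S q (S p) N), IHq, IHp.
      rewrite (pow_residue_S_S q p N); field; auto.
Qed.

(** Likewise with x = conj z + (x - conj z), lowering the order at conj z. *)
Lemma pow_residue_succ_r (q p N : nat) :
  pow_residue (S q) p (S N) = (Cconj z * pow_residue (S q) p N + pow_residue q p N)%C.
Proof.
  destruct p as [| p].
  - rewrite !pow_residue_0_r; ring.
  - rewrite pow_residue_succ_l, (pow_residue_S_S q p N); field; auto.
Qed.

(* Conjugation exchanges the two poles, hence the exchanged orders. *)
Definition pow_residue_sum (q p N : nat) : C :=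
  (pow_residue q p N + Cconj (pow_residue p q N))%C.

Lemma pow_residue_sum_succ_l (q p N : nat) :
  pow_residue_sum q (S p) (S N) =
  (z * pow_residue_sum q (S p) N + pow_residue_sum q p N)%C.
Proof.
  unfold pow_residue_sum; rewrite pow_residue_succ_l, pow_residue_succ_r.
  rewrite !Cplus_conj, Cmult_conj, Cconj_conj; ring.
Qed.

Lemma pow_residue_sum_succ_r (q p N : nat) :
  pow_residue_sum (S q) p (S N) =
  (Cconj z * pow_residue_sum (S q) p N + pow_residue_sum q p N)%C.
Proof.
  unfold pow_residue_sum; rewrite pow_residue_succ_l, pow_residue_succ_r.
  rewrite !Cplus_conj, Cmult_conj; ring.
Qed.

(** Follows by comparing the two ways of reducing the exponent N + 1, through z and through conj
    z. *)
Lemma pow_residue_sum_S_S (q p N : nat) :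
  pow_residue_sum (S q) (S p) N =
  ((pow_residue_sum q (S p) N - pow_residue_sum (S q) p N) / (z - Cconj z))%C.
Proof.
  assert (E := pow_residue_sum_succ_l (S q) p N); rewrite pow_residue_sum_succ_r in E.
  replace (pow_residue_sum q (S p) N) with (z * pow_residue_sum (S q) (S p) N
    + pow_residue_sum (S q) p N - Cconj z * pow_residue_sum (S q) (S p) N)%C
    by (rewrite <- E; ring).
  field; auto.
Qed.

(* A rational function O(x^-2) at infinity has residue sum 0. *)
Lemma pow_residue_sum_0 (q p : nat) :
  (2 <= q + p)%nat -> pow_residue_sum q p 0 = RtoC 0.
Proof.
  revert p; induction q as [| q IHq].
  - intros [| [| p]] H; [lia | lia |]; unfold pow_residue_sum; rewrite pow_residue_0_r.
    apply injective_projections; simpl; ring.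
  - induction p as [| p IHp]; intros H.
    + unfold pow_residue_sum; rewrite pow_residue_0_r; destruct q as [| q]; [lia |].
      apply injective_projections; simpl; ring.
    + rewrite pow_residue_sum_S_S.
      destruct (Nat.eq_dec (q + p) 0) as [E | E].
      * replace q with O by lia; replace p with O by lia.
        unfold pow_residue_sum; rewrite !pow_residue_0_r; unfold pow_residue; simpl.
        replace (Cconj 1) with (RtoC 1) by (apply injective_projections; simpl; ring).
        replace (Cconj 0) with (RtoC 0) by (apply injective_projections; simpl; ring).
        field; auto.
      * rewrite IHq, IHp by lia; field; auto.
Qed.

(** x^2 = (x - z)(x - conj z) + 2 Re z x - |z|^2, where the product lowers both orders by one. This
    is the recurrence of [quad_coef]. *)
Lemma pow_residue_sum_succ_succ (l N : nat) :
  pow_residue_sum (S l) (S l) (S (S N)) =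
  (pow_residue_sum l l N + RtoC (2 * Re z) * pow_residue_sum (S l) (S l) (S N)
   - RtoC (Cmod z ^ 2) * pow_residue_sum (S l) (S l) N)%C.
Proof.
  rewrite Cmod2_conj.
  replace (RtoC (2 * Re z)) with (z + Cconj z)%C
    by (apply injective_projections; unfold Re; simpl; ring).
  rewrite (pow_residue_sum_succ_l (S l) l (S N)), (pow_residue_sum_succ_r l l N).
  assert (E := pow_residue_sum_succ_l (S l) l N).
  replace (pow_residue_sum (S l) l N) with
    (pow_residue_sum (S l) (S l) (S N) - z * pow_residue_sum (S l) (S l) N)%C
    by (rewrite E; ring).
  ring.
Qed.

Lemma pow_residue_sum_1 (l : nat) : pow_residue_sum (S (S l)) (S (S l)) 1 = RtoC 0.
Proof.
  rewrite pow_residue_sum_succ_l, !pow_residue_sum_0 by lia; ring.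
Qed.

(** The total residue is the coefficient of 1/x at infinity of x^N / (x^2 - t x + m)^(l+1). With u =
    1/x it is the coefficient of u^(N-2l-1) in (1 - t u + m u^2)^(-(l+1)), whence the offset 2 l +
    1. One more level shifts the offset by 2, just as the recurrence shifts N. *)
Lemma pow_residue_sum_quad_coef (l : nat) :
  (forall N, (N <= 2 * l)%nat -> pow_residue_sum (S l) (S l) N = RtoC 0) /\
  (forall n, pow_residue_sum (S l) (S l) (2 * l + 1 + n) =
     RtoC (quad_coef (2 * Re z) (Cmod z ^ 2) (S l) n)).
Proof.
  set (t := 2 * Re z); set (m := Cmod z ^ 2).
  induction l as [| l [IH0 IHn]].
  - assert (H0 : pow_residue_sum 1 1 0 = RtoC 0) by (apply pow_residue_sum_0; lia).
    assert (H1 : pow_residue_sum 1 1 1 = RtoC 1).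
    { rewrite pow_residue_sum_succ_l, H0; unfold pow_residue_sum; rewrite pow_residue_0_r.
      unfold pow_residue; simpl; apply injective_projections; simpl; ring. }
    (* Without poles the sum is 0 for every N, while [quad_coef] at level 0 is 1 in degree 0; so the
       correspondence starts with simple poles, and that 1 enters through [H1]. *)
    assert (H00 : forall N, pow_residue_sum 0 0 N = RtoC 0).
    { intros N; unfold pow_residue_sum; rewrite pow_residue_0_r.
      apply injective_projections; simpl; ring. }
    split.
    + intros N HN; replace N with O by lia; exact H0.
    + apply nat_ind2.
      * exact H1.
      * change (2 * 0 + 1 + 1)%nat with 2%nat.
        rewrite pow_residue_sum_succ_succ, H00, H0, H1; fold t m.
        rewrite quad_coef_S_1, quad_coef_S_0; simpl.
        apply injective_projections; simpl; ring.
      * intros n E1 E2.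
        change (2 * 0 + 1 + S (S n))%nat with (S (S (S n))).
        change (2 * 0 + 1 + n)%nat with (S n) in E1.
        change (2 * 0 + 1 + S n)%nat with (S (S n)) in E2.
        rewrite pow_residue_sum_succ_succ, H00, E1, E2; fold t m.
        rewrite quad_coef_S_SS, RtoC_minus, RtoC_plus, !RtoC_mult.
        change (quad_coef t m 0 (S (S n))) with 0; ring.
  - assert (HZ : forall N, (N <= 2 * S l)%nat ->
      pow_residue_sum (S (S l)) (S (S l)) N = RtoC 0).
    { intros N; pattern N; apply nat_ind2.
      - intros _; apply pow_residue_sum_0; lia.
      - intros _; apply pow_residue_sum_1.
      - intros n E1 E2 Hn.
        rewrite pow_residue_sum_succ_succ, IH0, E1, E2 by lia; ring. }
    split; [exact HZ |].
    assert (H0 : pow_residue_sum (S (S l)) (S (S l)) (2 * S l + 1 + 0) =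
      RtoC (quad_coef t m (S (S l)) 0)).
    { replace (2 * S l + 1 + 0)%nat with (S (S (2 * l + 1 + 0))) by lia.
      rewrite pow_residue_sum_succ_succ, IHn, !HZ by lia.
      rewrite (quad_coef_S_0 _ _ (S l)); ring. }
    apply nat_ind2; [exact H0 | |].
    + replace (2 * S l + 1 + 1)%nat with (S (S (2 * l + 1 + 1))) by lia.
      rewrite pow_residue_sum_succ_succ, IHn, (HZ (2 * l + 1 + 1)%nat) by lia.
      replace (S (2 * l + 1 + 1)) with (2 * S l + 1 + 0)%nat by lia.
      fold t; rewrite H0, (quad_coef_S_1 _ _ (S l)), RtoC_plus, RtoC_mult; ring.
    + intros n E1 E2.
      replace (2 * S l + 1 + S (S n))%nat with (S (S (2 * l + 1 + S (S n)))) by lia.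
      replace (2 * S l + 1 + n)%nat with (2 * l + 1 + S (S n))%nat in E1 by lia.
      replace (2 * S l + 1 + S n)%nat with (S (2 * l + 1 + S (S n)))%nat in E2 by lia.
      rewrite pow_residue_sum_succ_succ, IHn, E1, E2; fold t m.
      rewrite (quad_coef_S_SS _ _ (S l)), RtoC_minus, RtoC_plus, !RtoC_mult; ring.
Qed.

End ResidueSum.

(* Unlike [Cinv_conj] this needs no hypothesis, since [/ 0] has both
   components [0 * / 0 = 0]. *)
Lemma Cinv_conj_total (w : C) : Cconj (/ w) = (/ Cconj w)%C.
Proof.
  destruct w as [x y]; unfold Cinv, Cconj; cbn [fst snd].
  replace ((- y) ^ 2) with (y ^ 2) by ring.
  apply injective_projections; cbn [fst snd]; unfold Rdiv; ring.
Qed.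

Lemma RtoC_conj (x : R) : Cconj (RtoC x) = RtoC x.
Proof. apply injective_projections; simpl; ring. Qed.

Lemma polylog_conj (s : nat) (w : C) : polylog s (Cconj w) = Cconj (polylog s w).
Proof.
  assert (E : forall n, (Cconj w ^ S n / RtoC (INR (S n) ^ s))%C =
                        Cconj (w ^ S n / RtoC (INR (S n) ^ s))%C).
  { intros n; unfold Cdiv.
    rewrite Cmult_conj, Cpow_conj, Cinv_conj_total, RtoC_conj; reflexivity. }
  unfold polylog, CSeries; apply injective_projections; cbn [Cconj fst snd].
  - apply Series_ext; intros n; rewrite E; reflexivity.
  - rewrite <- Series_opp; apply Series_ext; intros n; rewrite E; reflexivity.
Qed.

Lemma polylog_div_conj (s k : nat) (w : C) :
  Cconj (polylog s (Cconj w) / (Cconj w - w) ^ k)%C =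
  (polylog s w / (w - Cconj w) ^ k)%C.
Proof.
  unfold Cdiv; rewrite Cmult_conj, polylog_conj, Cconj_conj, Cinv_conj_total.
  rewrite Cpow_conj, Cminus_conj, Cconj_conj; reflexivity.
Qed.

Lemma is_series_RtoC (a : nat -> R) (l : C) :
  is_cseries (fun n => RtoC (a n)) l ->
  is_series (V := C_R_NormedModule) (fun n => RtoC (a n)) l.
Proof.
  intros [H1 H2].
  apply (filterlim_ext (fun n : nat => (sum_n a n, sum_n (fun _ => 0) n))).
  - intros n; induction n as [| n IH].
    + rewrite !sum_O; reflexivity.
    + rewrite !sum_Sn, <- IH; apply injective_projections; reflexivity.
  (* Balls of [C] are products of balls, so closeness is checked on each component. *)
  - apply (filterlim_locally (U := C_R_NormedModule)); intros eps.
    assert (E1 := proj1 (filterlim_locally _ _) H1 eps).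
    assert (E2 := proj1 (filterlim_locally _ _) H2 eps).
    generalize (filter_and _ _ E1 E2); apply filter_imp.
    intros n H; exact H.
Qed.

Theorem proposition4 (lam s : nat) (z : C)
  (hlam : (1 <= lam)%nat) (hz : Cmod z < 1) (hzbar : z <> Cconj z) :
  is_series (V := C_R_NormedModule)
    (fun n : nat => RtoC (sigma_term lam s z n))
    (Pz lam (fun w : C => polylog s w / Cpow (w - Cconj w) lam) z
     + Pzbar lam
         (fun w : C => polylog s (Cconj w) / Cpow (Cconj w - w) lam) z)%C
  /\ (forall (U : C -> Prop) (f : C -> C),
        @open C_UniformSpace U -> is_Ck (lam - 1) U f ->
        forall w : C, U w ->
          Pz lam f w = Pz_deriv lam f w /\
          Pzbar lam f w = Pzbar_deriv lam f w)
  /\ (forall (f : C -> C) (w : C), Pz 1 f w = f w /\ Pzbar 1 f w = f w).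
Proof.
  split; [| split].
  - apply is_series_RtoC.
    assert (Hd := minus_conj_neq_0 z hzbar).
    assert (Hz0 : z <> 0).
    { intros E; apply hzbar; rewrite E; apply injective_projections; simpl; ring. }
    rewrite Pzbar_conj.
    replace (fun v => Cconj (polylog s (Cconj v) / (Cconj v - v) ^ lam)%C)
      with (fun w => (polylog s w / (w - Cconj w) ^ lam)%C).
    2:{ apply functional_extensionality; intros v.
        rewrite polylog_div_conj; reflexivity. }
    destruct lam as [| m]; [lia |]; rewrite Pz_polylog by (split; auto).
    (* Expands the residue as a series over the power N of x in x^m Li_s(x); its conjugate is the
       other term. *)
    assert (H := is_cseries_part_frac (z - Cconj z) (polylog_coef s m)
      (taylor_pow z) (fun p => taylor_series (polylog_coef s m) p z)
      (fun p => taylor_series_correct _ (polylog_coef_bound s m) p z hz)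
      (S m) (S m)).
    assert (H' := is_cseries_plus _ _ _ _ H (is_cseries_conj _ _ H)).
    (* The residue sums vanish for N <= 2 m, and at N = 2 m + 1 + n the weight 1 / (N - m)^s is 1 /
       (lam + n)^s. *)
    apply (is_cseries_shift _ (2 * m + 1)) in H'.
    + revert H'; apply is_cseries_ext; intros n.
      destruct (pow_residue_sum_quad_coef z Hd m) as [_ E]; specialize (E n).
      unfold pow_residue_sum, pow_residue in E.
      rewrite sigma_term_quad_coef, RtoC_mult, <- E by auto.
      replace (polylog_coef s m (2 * m + 1 + n)) with (/ INR (S m + n) ^ s).
      * rewrite Cmult_conj, RtoC_conj; ring.
      * replace (2 * m + 1 + n)%nat with (S m + (m + n))%nat by lia.
        rewrite polylog_coef_shift; do 3 f_equal; lia.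
    + intros N HN.
      destruct (pow_residue_sum_quad_coef z Hd m) as [E _]; specialize (E N).
      unfold pow_residue_sum, pow_residue in E.
      rewrite Cmult_conj, RtoC_conj, <- Cmult_plus_distr_l, E by lia; ring.
  - intros U f HU Hf w Hw; apply is_Ck_iter_partials in Hf; split.
    + apply (Pz_eq_Pz_deriv lam U); auto.
    + rewrite Pzbar_conj, Pzbar_deriv_conj; f_equal.
      apply (Pz_eq_Pz_deriv lam U); auto; apply iter_partials_conj; auto.
  - intros f w; split; apply P_op_1.
Qed.
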